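(* Let $m>1$ be an integer, $\delta>-m$, and fix a positive integer $r$. In the preferential attachment graph process $\{G_{m,\delta}(t)\}_{t\ge1}$, for $t\ge r$ let $X(t)$ be the number of descendants of vertex $r$ among $[t]$ and $Y(t)$ the total degree (in $G_{m,\delta}(t)$) of these descendants, and set $p_X(t)=X(t)/t$, $p_Y(t)=Y(t)/(2mt)$. Then almost surely $\lim_{t\to\infty}p_X(t)=\lim_{t\to\infty}p_Y(t)=1$.
   Context: Preferential attachment process $\{G_{m,\delta}(t)\}_{t\ge1}$ (integer $m\ge1$, real $\delta\ge -m$): $G_{m,\delta}(1)$ is vertex $1$ with $m$ loops (a loop contributes $2$ to the degree). For $t\ge 1$, $G_{m,\delta}(t+1)$ is obtained by adding vertex $t+1$ and $m$ edges from it, one at a time: for $i=1,\dots,m$, with $d_{t,i-1}(x)$ the degree of $x$ just before the $i$-th edge of $t+1$ is added (so $d_{t,0}(t+1)=0$), the other endpoint $w$ of the $i$-th edge satisfies $\mathbb P(w=x)=\frac{d_{t,i-1}(x)+\delta}{(2m+\delta)t+2i-1+i\delta/m}$ for $x\in[t]$ and $\mathbb P(w=t+1)=\frac{d_{t,i-1}(t+1)+1+i\delta/m}{(2m+\delta)t+2i-1+i\delta/m}$ (a loop). Descendants of a fixed vertex $r$: $r$ is a descendant of itself; a vertex $x>r$ is a descendant of $r$ iff at least one of the edges added with $x$ at step $x$ goes to a vertex $y<x$ that is a descendant of $r$. *)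

(* Defs.v *)
From HB Require Import structures.
From mathcomp Require Import all_boot all_order all_algebra.
From mathcomp Require Import all_classical all_reals all_analysis.

Set Implicit Arguments.
Unset Strict Implicit.
Unset Printing Implicit Defensive.

Import Order.TTheory GRing.Theory Num.Theory.
Import numFieldNormedType.Exports.

Local Open Scope classical_set_scope.
Local Open Scope ring_scope.

(* A finite multigraph on positive integers, as the list of its edges in order
   of insertion; the edge (s, w) was inserted together with vertex s and has
   other endpoint w. *)
Definition multigraph := seq (nat * nat).

Definition degree (g : multigraph) (x : nat) : nat :=
  (\sum_(e <- g) ((e.1 == x) + (e.2 == x)))%N.

Inductive descendant (g : multigraph) (r : nat) : nat -> Prop :=
| descendant_refl : descendant g r r
| descendant_step (x y : nat) :
    (r < x)%N -> (x, y) \in g -> (y < x)%N -> descendant g r y ->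
    descendant g r x.

(* Given the other endpoint w s j of the j-th edge of vertex s (1 <= j <= m),
   this is G(t) together with the first k edges of vertex t+1. *)
Definition partial_graph (m : nat) (w : nat -> nat -> nat) (t k : nat) :
    multigraph :=
  [seq (s, w s j) | s <- iota 1 t, j <- iota 1 m] ++
  [seq (t.+1, w t.+1 j) | j <- iota 1 k].

Definition graph_at (m : nat) (w : nat -> nat -> nat) (t : nat) : multigraph :=
  partial_graph m w t 0.

(* Probability that the i-th edge of vertex t+1 goes to x, where g is the graph
   just before that edge is inserted. *)
Definition attach_prob (R : realType) (m : nat) (delta : R)
    (g : multigraph) (t i x : nat) : R :=
  let den := (2 * m%:R + delta) * t%:R + 2 * i%:R - 1 + i%:R * delta / m%:R in
  if (1 <= x <= t)%N then ((degree g x)%:R + delta) / den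
  else if x == t.+1 then ((degree g x)%:R + 1 + i%:R * delta / m%:R) / den
  else 0.

(* pa_law is the conditional law of each new endpoint given the past, in
   product form: since a multigraph lists all edges in order of insertion, the
   event partial_graph = g fixes the whole history of the process. *)
Record pref_attach (d : measure_display) (T : measurableType d) (R : realType)
    (P : probability T R) (m : nat) (delta : R) (w : nat -> nat -> T -> nat) :
    Prop := PrefAttach {
  pa_measurable : forall s i : nat, (1 <= s)%N -> (1 <= i <= m)%N ->
    measurable_fun setT (w s i);
  pa_init : forall (i : nat) (omega : T), (1 <= i <= m)%N -> w 1%N i omega = 1%N;
  pa_law : forall (t i : nat) (g : multigraph) (x : nat),
    (1 <= t)%N -> (1 <= i <= m)%N ->
    let past := [set omega |
      partial_graph m (fun s j => w s j omega) t i.-1 = g] in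
    P (past `&` [set omega | w t.+1 i omega = x]) =
      (P past * (attach_prob m delta g t i x)%:E)%E }.

Definition descendant_count (g : multigraph) (r t : nat) : nat :=
  (\sum_(1 <= x < t.+1 | `[< descendant g r x >]) 1)%N.

Definition descendant_degree (g : multigraph) (r t : nat) : nat :=
  (\sum_(1 <= x < t.+1 | `[< descendant g r x >]) degree g x)%N.

Section Proportions.
Variables (T : Type) (R : realType) (m : nat) (w : nat -> nat -> T -> nat).
Variable r : nat.

Definition pa_graph (t : nat) (omega : T) : multigraph :=
  graph_at m (fun s j => w s j omega) t.

Definition p_X (t : nat) (omega : T) : R :=
  (descendant_count (pa_graph t omega) r t)%:R / t%:R.

Definition p_Y (t : nat) (omega : T) : R :=
  (descendant_degree (pa_graph t omega) r t)%:R / (2 * m%:R * t%:R).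

End Proportions.

(* Main.v *)
Require Import Defs.
From HB Require Import structures.
From mathcomp Require Import all_boot all_order all_algebra.
From mathcomp Require Import all_classical all_reals all_analysis.
From mathcomp Require Import measurable_realfun zify ring lra.

Import Order.TTheory GRing.Theory Num.Theory.
Import numFieldNormedType.Exports.

Local Open Scope classical_set_scope.
Local Open Scope ring_scope.

Set Implicit Arguments.
Unset Strict Implicit.
Unset Printing Implicit Defensive.

(* Let Z(t) and N(t) be the sums of degree + delta over the descendants and the
   non-descendants in [t], so that Z + N = (2m + delta) t.  Given the past, the
   new vertex is a non-descendant with probability about (N/(Z+N))^m, and since
   m > 1 and m + delta > 0 the ratio V = N/Z satisfies
     E[V(t+1) | past] <= (1 - eps/t) V(t) + C/t^2    whenever Z(t) >= K,
   for constants K, eps, C.  Similarly E[1/Z(t+1) | past] <= (1 - c/t) / Z(t)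
   without any lower bound on Z.  A nonnegative process with such a drift has
   almost surely a finite sum of f(t)/t: the drift inequality telescopes in
   expectation, so no martingale convergence theorem is used.  For f = 1/Z this
   forces Z(t) >= K eventually, because the harmonic series diverges; for f = V
   restricted to the event Z(n) >= K it gives that the sum of N(t)/t^2 is finite.
   As N is nondecreasing, N(t)/t tends to 0, and N bounds both the number and the
   total degree of the non-descendants up to a constant factor. *)

(** * Real inequalities and summability *)

(** In the induction the quadratic coefficient passes from c to at most c + n + c x, and n <= c and
    x <= 1 make this at most 3 c. It is applied with x = 1/(B t), where the quadratic term has order
    1/t^2. *)
Lemma expr1D_le (R : realFieldType) (x : R) (n : nat) : 0 <= x <= 1 ->
  (1 + x) ^+ n <= 1 + n%:R * x + 3 ^+ n * x ^+ 2.
Proof.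
move=> /andP[x0 x1]; elim: n => [|n IH]; first by rewrite !expr0; nra.
have n3 : n%:R <= 3 ^+ n :> R by rewrite -natrX ler_nat ltnW // ltn_expl.
have c0 : 0 <= 3 ^+ n :> R by rewrite exprn_ge0.
rewrite exprSr; apply: le_trans (ler_wpM2r _ IH) _; first lra.
rewrite -[n.+1]addn1 natrD exprD expr1.
move: (3 ^+ n) n3 c0 => c n3 c0.
have x2 : 0 <= x ^+ 2 by rewrite exprn_ge0.
have := ler_wpM2r x2 n3.
have cx := mulr_ge0 c0 x2.
have : x * (c * x ^+ 2) <= 1 * (c * x ^+ 2) by rewrite ler_wpM2r.
lra.
Qed.

(* Subtracting, n'z - nz' = b (t (n' - n) - n), so the increment of the ratio
   has no term in z' - z except through the denominator z'. *)
Lemma ratio_increment (R : realFieldType) (n z n' z' b t c a : R) :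
  0 < b -> 0 <= t -> 0 <= n <= n' -> 0 < z <= z' ->
  n + z = b * t -> n' + z' = b * (t + 1) -> z' - z <= c * a ->
  n' / z' <= n / z - b * n / z ^+ 2 + b * t / z ^+ 2 * (n' - n)
             + b * n * c / z ^+ 3 * a.
Proof.
move=> b0 t0 /andP[n0 nn] /andP[z0 zz] e e' za.
have z'0 : 0 < z' by lra.
have -> : n' / z' = n / z + b * (t * (n' - n) - n) / (z * z').
  have -> : b * (t * (n' - n) - n) = n' * z - n * z'.
    have -> : z = b * t - n by lra.
    have -> : z' = b * (t + 1) - n' by lra.
    by ring.
  by field; do ?[apply/andP; split]; apply: lt0r_neq0.
set T := t * (n' - n) - n.
have T_ge : - n <= T by rewrite /T; have := mulr_ge0 t0 (_ : 0 <= n' - n); lra.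
(* Replacing z' by z in the denominator costs a term with factor - T, which is at most n by
   [T_ge]. *)
have -> : b * T / (z * z') = b * T / z ^+ 2 + b * (- T) * (z' - z) / (z ^+ 2 * z').
  by field; do ?[apply/andP; split]; apply: lt0r_neq0.
have h : b * (- T) * (z' - z) / (z ^+ 2 * z') <= b * n * (c * a) / z ^+ 3.
  apply: le_trans (_ : b * n * (z' - z) / (z ^+ 2 * z') <= _).
    rewrite ler_wpM2r ?invr_ge0 ?mulr_ge0 ?exprn_ge0 ?(ltW z0) ?(ltW z'0) //.
    by rewrite ler_wpM2r ?ler_wpM2l //; lra.
  apply: ler_pM.
  - by rewrite !mulr_ge0 ?(ltW b0) //; lra.
  - by rewrite invr_ge0 !mulr_ge0 ?exprn_ge0 ?(ltW z0) ?(ltW z'0).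
  - by rewrite ler_wpM2l // mulr_ge0 // ltW.
  rewrite lef_pV2 ?posrE ?mulr_gt0 ?exprn_gt0 //.
  by rewrite exprSr ler_wpM2l ?exprn_ge0 ?(ltW z0).
have -> : n / z - b * n / z ^+ 2 + b * t / z ^+ 2 * (n' - n) + b * n * c / z ^+ 3 * a
  = n / z + (b * T / z ^+ 2 + b * n * (c * a) / z ^+ 3).
  by rewrite /T; field; apply: lt0r_neq0.
by rewrite !lerD2l.
Qed.

(** Up to the positive factor 1/(W z^2), the leading terms are - (M + q) n W + M n W + q n^2 = - q n
    z, because n - W = - z. The square of [p] is what produces n^2, hence the negative drift. The
    remaining terms are linear in n, with coefficient C7, or constant, with value C6. *)
Lemma ratio_drift_bound (R : realFieldType) (n z W M q C1 C4 lam p : R) :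
  0 <= n -> 1 <= z -> W = n + z -> 0 <= M -> 0 <= q -> 0 <= C1 -> 0 <= C4 ->
  lam <= M / W + C4 / W ^+ 2 -> p = (W + C1 - z) / (W + C1) ->
  forall C6 C7, C7 = C4 + 2 * q * C1 + M * C1 + (M + q) * (1 + C1) * (M + C4) ->
  C6 = (M + q) * C1 ^+ 2 ->
  n / z - (M + q) * n / z ^+ 2
    + W / z ^+ 2 * (n * lam + q * p ^+ 2 + M * (C1 / W) * p)
    + (M + q) * n * (1 + C1) / z ^+ 3 * (z * lam)
  <= n / z * (1 - q / W + (C7 + C6) / (z * W)) + C6 / W ^+ 2.
Proof.
move=> n0 z1 WE M0 q0 C10 C40 lamW pE C6 C7 C7E C6E.
have W1 : 1 <= W by lra.
have C60 : 0 <= C6 by rewrite C6E mulr_ge0 ?exprn_ge0 ?addr_ge0.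
have lW : W * (W * lam) <= W * M + C4.
  have -> : W * M + C4 = W * (W * (M / W + C4 / W ^+ 2)).
    by field; apply: lt0r_neq0; lra.
  by rewrite !ler_wpM2l //; lra.
have lW' : W * lam <= M + C4.
  have : W * (W * lam) <= W * (M + C4) by nra.
  by rewrite ler_pM2l //; lra.
have P0 : 0 <= W * p by rewrite pE !mulr_ge0 ?invr_ge0 //; lra.
have P1 : W * p <= n + C1.
  by rewrite pE mulrA ler_pdivrMr; nra.
have -> : n / z - (M + q) * n / z ^+ 2
    + W / z ^+ 2 * (n * lam + q * p ^+ 2 + M * (C1 / W) * p)
    + (M + q) * n * (1 + C1) / z ^+ 3 * (z * lam) =
  n / z + (- (M + q) * n * W + n * (W * (W * lam)) + q * (W * p) ^+ 2
    + M * C1 * (W * p) + (M + q) * n * (1 + C1) * (W * lam)) / (W * z ^+ 2).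
  by field; do ?[apply/andP; split]; apply: lt0r_neq0; lra.
have -> : n / z * (1 - q / W + (C7 + C6) / (z * W)) + C6 / W ^+ 2 =
  n / z + (- q * n * z + (C7 + C6) * n + C6 * z ^+ 2 / W) / (W * z ^+ 2).
  by field; do ?[apply/andP; split]; apply: lt0r_neq0; lra.
rewrite lerD2l ler_wpM2r ?invr_ge0 ?mulr_ge0 ?exprn_ge0 //; try lra.
have h1 : n * (W * (W * lam)) <= n * (W * M + C4) by rewrite ler_wpM2l.
have h2 : q * (W * p) ^+ 2 <= q * (n + C1) ^+ 2.
  by rewrite ler_wpM2l // lerXn2r // nnegrE; lra.
have h3 : M * C1 * (W * p) <= M * C1 * (n + C1) by rewrite ler_wpM2l ?mulr_ge0.
have h4 : (M + q) * n * (1 + C1) * (W * lam) <= (M + q) * n * (1 + C1) * (M + C4).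
  by rewrite ler_wpM2l // !mulr_ge0 //; lra.
(* The constant is split: the first part joins C7 in the drift factor, the second becomes C6 / W^2
   after division by W z^2. It holds since n W + z^2 >= W when z >= 1. *)
have h5 : C6 <= C6 * n + C6 * z ^+ 2 / W.
  rewrite -mulrA -mulrDr ler_peMr // -(ler_pM2r (_ : 0 < W)); last lra.
  rewrite mulrDl mulfVK; last by apply: lt0r_neq0; lra.
  by rewrite WE; nra.
move: h5; move: (C6 * z ^+ 2 / W) => c h5.
move: h1 h2 h3 h4 h5; rewrite WE C7E C6E.
lra.
Qed.

(** Since C/t^2 <= 2C/t - 2C/(t+1), the term eps e(t)/t is at most the decrease of e(t) + 2C/t over
    one step, and the sum telescopes. *)
Lemma drift_sum_le (R : realFieldType) (e : nat -> R) (eps C : R) (n : nat) :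
  (1 <= n)%N -> 0 < eps -> 0 <= C -> (forall t, (n <= t)%N -> 0 <= e t) ->
  (forall t, (n <= t)%N ->
    e t.+1 <= (1 - eps / t%:R) * e t + C / t%:R ^+ 2) ->
  forall M, \sum_(n <= t < M) e t / t%:R <= (e n + 2 * C / n%:R) / eps.
Proof.
move=> n1 eps0 C0 e0 eS M; rewrite ler_pdivlMr // mulrC.
have [Mn|nM] := leqP M n.
  by rewrite big_geq // mulr0 addr_ge0 ?e0 // divr_ge0 // mulr_ge0.
apply: le_trans (_ : e n + 2 * C / n%:R - (e M + 2 * C / M%:R) <= _); last first.
  by rewrite gerBl addr_ge0 ?e0 1?ltnW // divr_ge0 // mulr_ge0.
rewrite -(subnKC (ltnW nM)); elim: (M - n)%N => [|k IH].
  by rewrite addn0 big_geq // mulr0; lra.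
rewrite addnS big_nat_recr ?leq_addr //= mulrDr.
have nk : (n <= n + k)%N by rewrite leq_addr.
have t1 : 1 <= (n + k)%:R :> R by rewrite ler1n; lia.
have := eS _ nk; move: IH t1; move: (n + k)%N => t IH + h.
rewrite -(natr1 t); move: (t%:R : R) IH h => x IH h x1.
have hC : C / x ^+ 2 <= 2 * C / x - 2 * C / (x + 1).
  have -> : 2 * C / x - 2 * C / (x + 1) = C * (2 / (x * (x + 1))).
    by field; apply/andP; split; apply: lt0r_neq0; lra.
  rewrite ler_wpM2l // ler_pdivlMr; last by apply: mulr_gt0; lra.
  rewrite mulrC ler_pdivrMr; last by apply: exprn_gt0; lra.
  by nra.
have -> : eps * (e t / x) = eps / x * e t by ring.
lra.
Qed.

Lemma harmonic_tail_unbounded (R : realType) (K L : R) (n : nat) : (1 <= n)%N ->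
  0 < K -> ~ (forall M, \sum_(n <= t < M) K / t%:R <= L).
Proof.
move=> n1 K0 h; apply: (@dvg_harmonic R).
apply: nondecreasing_is_cvgn.
  by apply: nondecreasing_series => k _ _; exact: harmonic_ge0.
exists (\sum_(0 <= k < n) harmonic k + L / K) => _ [M _ <-].
have [Mn|nM] := leqP M n.
  rewrite /series /= (big_cat_nat _ Mn) //= -addrA lerDl addr_ge0 //.
    by apply: sumr_ge0 => k _; exact: harmonic_ge0.
  rewrite divr_ge0 ?(ltW K0) //; apply: le_trans (h n); by rewrite big_geq.
rewrite /series /= (big_cat_nat _ (ltnW nM)) //= lerD2l ler_pdivlMr //.
apply: le_trans (h M); rewrite mulr_suml !big_nat; apply: ler_sum => k /andP[nk _].
(* [harmonic k] is 1/(k+1), which is at most 1/k. *)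
rewrite mulrC ler_wpM2l ?(ltW K0) // lef_pV2 ?posrE ?ltr0n //; last by lia.
by rewrite ler_nat.
Qed.

(** By monotonicity the block of the series over [t, 2t) is at least u(t)/(4t), and this block is
    bounded by the tail of a convergent series. *)
Lemma monotone_ratio_cvg0 (R : realType) (u : nat -> R) (n : nat) (L : R) :
  (forall t, 0 <= u t) -> nondecreasing_seq u ->
  (forall M, \sum_(n <= t < M) u t / t%:R ^+ 2 <= L) ->
  u t / t%:R @[t --> \oo] --> (0 : R).
Proof.
move=> u0 uS uL.
pose s M := \sum_(n <= t < M) u t / t%:R ^+ 2.
have term0 t : 0 <= u t / t%:R ^+ 2 by rewrite divr_ge0 ?exprn_ge0.
have sS : nondecreasing_seq s.
  apply/nondecreasing_seqP => M; rewrite /s.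
  have [nM|Mn] := leqP n M; first by rewrite big_nat_recr //= lerDl.
  by rewrite !big_geq // ltnW.
have scvg : cvgn s.
  by apply: nondecreasing_is_cvgn => //; exists L => _ [M _ <-]; exact: uL.
have tail : (4 * (limn s - s t)) @[t --> \oo] --> (0 : R).
  rewrite -[X in _ --> X](mulr0 4) -(subrr (limn s)).
  by apply: cvgM; [exact: cvg_cst | apply: cvgB; [exact: cvg_cst | exact: scvg]].
apply: (squeeze_cvgr (f := fun=> 0)) tail; [|exact: cvg_cst].
near=> t; rewrite divr_ge0 //=.
have t1 : (1 <= t)%N by near: t; exact: nbhs_infty_ge.
have nt : (n <= t)%N by near: t; exact: nbhs_infty_ge.
apply: le_trans (_ : 4 * (s (2 * t)%N - s t) <= _); last first.
  by rewrite ler_wpM2l // lerD2r; exact: nondecreasing_cvgn_le.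
have -> : s (2 * t)%N - s t = \sum_(t <= i < (2 * t)%N) u i / i%:R ^+ 2.
  rewrite /s (big_cat_nat nt) /=; last by lia.
  by rewrite addrAC subrr add0r.
(* There are t equal terms u(t)/(4 t^2), so the factor 4 restores u(t)/t exactly. *)
apply: le_trans (_ : 4 * \sum_(t <= i < (2 * t)%N) u t / (2 * t%:R) ^+ 2 <= _).
  rewrite sumr_const_nat (_ : (2 * t - t)%N = t); last by lia.
  rewrite -mulr_natr le_eqVlt; apply/orP; left; apply/eqP; field.
  by rewrite pnatr_eq0; lia.
rewrite ler_wpM2l // !big_nat; apply: ler_sum => i /andP[ti it].
apply: ler_pM; rewrite ?invr_ge0 ?exprn_ge0 ?mulr_ge0 //; first exact: uS.
have i0 : 0 < i%:R :> R by rewrite ltr0n; lia.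
have t0 : 0 < t%:R :> R by rewrite ltr0n.
rewrite lef_pV2 ?posrE ?exprn_gt0 ?mulr_gt0 //.
rewrite lerXn2r ?nnegrE ?mulr_ge0 //.
by rewrite -natrM ler_nat ltnW.
Unshelve. all: by end_near. Qed.

(** * Degrees and descendants *)

Lemma degree_rcons (g : multigraph) (s x y : nat) :
  degree (rcons g (s, x)) y = (degree g y + ((s == y) + (x == y)))%N.
Proof. by rewrite /degree -cats1 big_cat /= big_seq1. Qed.

Lemma degree_total (g : multigraph) (n : nat) :
  all (fun e => (1 <= e.2 <= e.1)%N && (e.1 < n)%N) g ->
  (\sum_(1 <= x < n) degree g x)%N = (2 * size g)%N.
Proof.
rewrite /degree exchange_big /=.
have one (y : nat) : (1 <= y < n)%N -> (\sum_(1 <= x < n) (y == x) = 1)%N.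
  move=> yn; under eq_bigr do rewrite eq_sym.
  rewrite (bigD1_seq y) ?mem_index_iota ?iota_uniq //= eqxx big1 //.
  by move=> i /negbTE ->.
elim: g => [|e g IH] /=; first by rewrite big_nil.
case/andP=> /andP[/andP[e1 e2] e3] /IH; rewrite big_cons => ->.
by rewrite big_split /= !one; lia.
Qed.

(** A chain of edges from y down to r visits only vertices at most y, so it never uses an edge
    inserted with t+1. *)
Lemma descendant_rcons_le (g : multigraph) (r t x y : nat) : (y <= t)%N ->
  descendant (rcons g (t.+1, x)) r y <-> descendant g r y.
Proof.
move=> yt; split => h; move: yt; elim: h => {y} [|y z ry yz zy _ IH] yt;
  try exact: descendant_refl.
- apply: (@descendant_step _ _ _ z) => //; last by apply: IH; lia.
  move: yz; rewrite mem_rcons inE => /orP[/eqP[yt1 _]|//]; lia.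
- apply: (@descendant_step _ _ _ z) => //; last by apply: IH; lia.
  by rewrite mem_rcons inE yz orbT.
Qed.

Lemma descendant_inv (g : multigraph) (r x : nat) : descendant g r x ->
  x = r \/ exists y, [/\ (r < x)%N, (x, y) \in g, (y < x)%N & descendant g r y].
Proof. by case=> [|y z ry yz zy dz]; [left | right; exists z]. Qed.

(** The edge that makes t+1 a descendant is either an earlier one or the new one; a new loop, x =
    t+1, changes nothing. *)
Lemma descendant_rcons_new (g : multigraph) (r t x : nat) : (r <= t)%N ->
  descendant (rcons g (t.+1, x)) r t.+1 <->
  descendant g r t.+1 \/ (x <= t)%N /\ descendant g r x.
Proof.
move=> rt; split.
  case/descendant_inv => [|[z [_ + zt dz]]]; first by lia.
  have {}dz : descendant g r z by apply/(@descendant_rcons_le _ _ t x).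
  rewrite mem_rcons inE => /orP[/eqP[<-]|tz]; first by right.
  by left; apply: (@descendant_step _ _ _ z).
case=> [/descendant_inv[|[z [_ tz zt dz]]]|[xt dx]]; first by lia.
  apply: (@descendant_step _ _ _ z) => //.
    by rewrite mem_rcons inE tz orbT.
  by apply/descendant_rcons_le.
apply: (@descendant_step _ _ _ x) => //; first by rewrite mem_rcons inE eqxx.
by apply/descendant_rcons_le.
Qed.

(** * Weights of the descendants and of the non-descendants *)

Section Weights.
Variables (R : realType) (m : nat) (delta : R) (r : nat).

Definition is_desc (g : multigraph) (x : nat) : bool := `[< descendant g r x >].

(** The sum stops at t even when [g] already has edges of t+1. Thus each inserted edge changes the
    weights by 0 or 1, and vertex t+1 is counted only after its last edge. *)
Definition desc_weight (g : multigraph) (t : nat) : R :=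
  \sum_(1 <= x < t.+1 | is_desc g x) ((degree g x)%:R + delta).

Definition nondesc_weight (g : multigraph) (t : nat) : R :=
  \sum_(1 <= x < t.+1 | ~~ is_desc g x) ((degree g x)%:R + delta).

(* The deterministic properties of G(t) together with the first k edges of
   vertex t+1. *)
Record history_inv (t k : nat) (g : multigraph) : Prop := HistoryInv {
  history_size : size g = (m * t + k)%N;
  history_ends : all (fun e => (1 <= e.2 <= e.1)%N && (e.1 < t.+2)%N) g;
  history_old_degree : forall x, (1 <= x <= t)%N -> (m <= degree g x)%N;
  history_new_degree : (k <= degree g t.+1 <= 2 * k)%N }.

Lemma history_inv_rcons (t k x : nat) (g : multigraph) :
  history_inv t k g -> (1 <= x <= t.+1)%N ->
  history_inv t k.+1 (rcons g (t.+1, x)).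
Proof.
move=> [sz en od nd] xt; split.
- by rewrite size_rcons sz; lia.
- by rewrite all_rcons en /= andbT; lia.
- by move=> y yt; rewrite degree_rcons; have := od y yt; lia.
- by rewrite degree_rcons eqxx; case: (x == _); lia.
Qed.

Lemma history_inv_next (t : nat) (g : multigraph) :
  history_inv t m g -> history_inv t.+1 0 g.
Proof.
move=> [sz en od nd]; split.
- by rewrite sz; lia.
- by apply: sub_all en => e /=; lia.
- move=> y yt; have [->|yt1] := eqVneq y t.+1; first by lia.
  by apply: od; lia.
- have -> : degree g t.+2 = 0%N; last by lia.
  rewrite /degree big_seq big1 // => e /(allP en) /= h.
  by rewrite !ltn_eqF //; lia.
Qed.

Lemma is_desc_root (g : multigraph) : is_desc g r.
Proof. by apply/asboolP; exact: descendant_refl. Qed.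

Lemma is_desc_rcons_le (g : multigraph) (t x y : nat) : (y <= t)%N ->
  is_desc (rcons g (t.+1, x)) y = is_desc g y.
Proof. by move=> yt; apply/asbool_equiv_eq; exact: descendant_rcons_le. Qed.

Lemma is_desc_rcons_new (g : multigraph) (t x : nat) : (r <= t)%N ->
  is_desc (rcons g (t.+1, x)) t.+1 =
  is_desc g t.+1 || (x <= t)%N && is_desc g x.
Proof.
move=> rt; apply/asboolP/idP.
  case/(descendant_rcons_new _ _ rt) => [dt|[-> dx]].
    by apply/orP; left; apply/asboolP.
  by apply/orP; right; apply/asboolP.
move=> h; apply/(descendant_rcons_new _ _ rt).
case/orP: h => [/asboolP|/andP[xt /asboolP]]; first by left.
by right.
Qed.

Lemma is_desc_new (t : nat) (g : multigraph) : (r <= t)%N ->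
  history_inv t 0 g -> is_desc g t.+1 = false.
Proof.
move=> rt [_ _ _ nd]; apply/negbTE/negP => /asboolP /descendant_inv [|]; first lia.
move=> [y [_ ty _ _]]; move: nd.
rewrite /degree (big_rem _ ty) /= eqxx; lia.
Qed.

(** The predicate [A] does not depend on the graph, so that this serves both weights: the status of
    the vertices of [t] is unchanged by the new edge. *)
Lemma weight_rcons (A : pred nat) (g : multigraph) (t x : nat) :
  (1 <= x <= t.+1)%N ->
  \sum_(1 <= y < t.+1 | A y) ((degree (rcons g (t.+1, x)) y)%:R + delta) =
  \sum_(1 <= y < t.+1 | A y) ((degree g y)%:R + delta)
    + ((x <= t)%N && A x)%:R.
Proof.
move=> xt.
have -> : ((x <= t)%N && A x)%:R = \sum_(1 <= y < t.+1 | A y) (x == y)%:R :> R.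
  have [xt'|xt'] := leqP x t; last first.
    rewrite big_nat_cond big1 // => y /andP[/andP[_ yt] _].
    by rewrite (gtn_eqF _) //; lia.
  rewrite big_mkcond (bigD1_seq x) ?iota_uniq //=; last first.
    by rewrite mem_index_iota; lia.
  rewrite eqxx big1 ?addr0; first by case: (A x).
  by move=> y; rewrite eq_sym => /negbTE ->; case: (A y).
rewrite -big_split /= big_nat_cond [RHS]big_nat_cond; apply: eq_bigr.
move=> y /andP[/andP[_ yt] _]; rewrite degree_rcons natrD.
have -> : (t.+1 == y) = false by rewrite gtn_eqF.
by rewrite add0n addrAC.
Qed.

Lemma desc_weight_rcons (g : multigraph) (t x : nat) : (1 <= x <= t.+1)%N ->
  desc_weight (rcons g (t.+1, x)) t =
  desc_weight g t + ((x <= t)%N && is_desc g x)%:R.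
Proof.
move=> xt; rewrite -(weight_rcons (is_desc g)) // /desc_weight.
rewrite big_nat_cond [RHS]big_nat_cond; apply: eq_bigl => y.
by case: (boolP (1 <= y < t.+1)%N) => //= yt; rewrite is_desc_rcons_le //; lia.
Qed.

Lemma nondesc_weight_rcons (g : multigraph) (t x : nat) : (1 <= x <= t.+1)%N ->
  nondesc_weight (rcons g (t.+1, x)) t =
  nondesc_weight g t + ((x <= t)%N && ~~ is_desc g x)%:R.
Proof.
move=> xt; rewrite -(weight_rcons (fun y => ~~ is_desc g y)) // /nondesc_weight.
rewrite big_nat_cond [RHS]big_nat_cond; apply: eq_bigl => y.
by case: (boolP (1 <= y < t.+1)%N) => //= yt; rewrite is_desc_rcons_le //; lia.
Qed.

Lemma desc_weightS (g : multigraph) (t : nat) :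
  desc_weight g t.+1 = desc_weight g t +
    (if is_desc g t.+1 then (degree g t.+1)%:R + delta else 0).
Proof. by rewrite /desc_weight big_mkcond big_nat_recr //= -big_mkcond. Qed.

Lemma nondesc_weightS (g : multigraph) (t : nat) :
  nondesc_weight g t.+1 = nondesc_weight g t +
    (if is_desc g t.+1 then 0 else (degree g t.+1)%:R + delta).
Proof.
rewrite /nondesc_weight big_mkcond big_nat_recr //= -big_mkcond.
by case: is_desc.
Qed.

(** The m t + k edges give total degree 2 (m t + k), and each vertex of [t] adds delta. *)
Lemma total_weight (t k : nat) (g : multigraph) : history_inv t k g ->
  desc_weight g t + nondesc_weight g t + (degree g t.+1)%:R =
  (2 * m%:R + delta) * t%:R + 2 * k%:R.
Proof.
move=> [sz en _ _]; have := degree_total en.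
rewrite big_nat_recr //= sz => dt.
have -> : desc_weight g t + nondesc_weight g t =
    (\sum_(1 <= x < t.+1) degree g x)%N%:R + delta * t%:R.
  transitivity (\sum_(1 <= x < t.+1) ((degree g x)%:R + delta)).
    by rewrite [RHS](bigID (is_desc g)).
  by rewrite big_split /= natr_sum sumr_const_nat subn1 /= mulr_natr.
have : ((\sum_(1 <= x < t.+1) degree g x)%N + degree g t.+1)%:R =
  (2 * (m * t + k))%:R :> R by rewrite dt.
by rewrite !(natrD, natrM) => e; lra.
Qed.

(** * Expectation over the next edges of vertex t+1 *)

Hypotheses (m_gt1 : (1 < m)%N) (delta_gt : - m%:R < delta).

Local Notation Z := desc_weight.
Local Notation N := nondesc_weight.
Local Notation desc := is_desc.
Local Notation hinv := history_inv.
Local Notation B := (2 * m%:R + delta).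
Local Notation C1 := (2 * m%:R + `|delta|).

Lemma m_ge2 : 2 <= m%:R :> R. Proof. by rewrite ler_nat. Qed.

Lemma min_weight_gt0 : 0 < m%:R + delta.
Proof. by rewrite -ltrBlDl sub0r. Qed.

(** With k edges of t+1 placed, the next edge has index i = k+1. This is then the denominator of
    [attach_prob], and [loop_weight] is the numerator for the endpoint t+1. *)
Definition denom (t k : nat) : R :=
  B * t%:R + 2 * k.+1%:R - 1 + k.+1%:R * delta / m%:R.

Definition loop_weight (k : nat) (g : multigraph) (t : nat) : R :=
  (degree g t.+1)%:R + 1 + k.+1%:R * delta / m%:R.

(** Here (k+1)/m lies in [0, 1] and delta > -m. The lower bound - (k+1) is just enough to make
    [denom] at least B t and [loop_weight] nonnegative. *)
Lemma edge_shift_bounds (k : nat) : (k < m)%N ->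
  - k.+1%:R <= k.+1%:R * delta / m%:R <= `|delta|.
Proof.
move=> km; have m2 := m_ge2.
have mi : m%:R^-1 * m%:R = 1 :> R by rewrite mulVf //; lra.
have k0 : 0 <= k.+1%:R :> R by [].
have kmR : k.+1%:R * m%:R^-1 <= 1 :> R.
  by rewrite ler_pdivrMr ?mul1r ?ler_nat //; lra.
have ki : 0 <= k.+1%:R * m%:R^-1 :> R by rewrite divr_ge0 //; lra.
rewrite mulrAC; apply/andP; split; last first.
  apply: le_trans (_ : k.+1%:R / m%:R * `|delta| <= _).
    by rewrite ler_wpM2l // ler_norm.
  by rewrite -[leRHS]mul1r ler_wpM2r.
apply: le_trans (_ : k.+1%:R / m%:R * - m%:R <= _).
  by rewrite mulrN lerN2 -mulrA mi mulr1.
by rewrite ler_wpM2l // ltW.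
Qed.

Lemma denom_total (t k : nat) (g : multigraph) : hinv t k g ->
  Z g t + N g t + loop_weight k g t = denom t k.
Proof.
move=> /total_weight h.
by rewrite /loop_weight /denom -[k.+1]addn1 natrD; lra.
Qed.

Lemma denom_bounds (t k : nat) : (k < m)%N ->
  B * t%:R <= denom t k <= B * t%:R + C1.
Proof.
move=> km; have /andP[h1 h2] := edge_shift_bounds km.
have : k.+1%:R <= m%:R :> R by rewrite ler_nat.
have : 1 <= k.+1%:R :> R by rewrite ler1n.
by rewrite /denom => h3 h4; apply/andP; split; lra.
Qed.

Lemma loop_weight_bounds (t k : nat) (g : multigraph) : (k < m)%N ->
  hinv t k g -> 0 <= loop_weight k g t <= C1.
Proof.
move=> km [_ _ _ /andP[d1 d2]]; have /andP[h1 h2] := edge_shift_bounds km.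
have : k.+1%:R <= m%:R :> R by rewrite ler_nat.
move: d1 d2; rewrite /loop_weight -(ler_nat R) -(ler_nat R) natrM.
move: h1 h2; rewrite -[k.+1]addn1 natrD => h1 h2 d1 d2 km'; apply/andP; split; lra.
Qed.

Lemma old_weight_ge (t k x : nat) (g : multigraph) : hinv t k g ->
  (1 <= x <= t)%N -> m%:R + delta <= (degree g x)%:R + delta.
Proof. by move=> [_ _ od _] /od; rewrite lerD2r ler_nat. Qed.

Lemma desc_weight_ge (t k : nat) (g : multigraph) : hinv t k g ->
  (1 <= r <= t)%N -> m%:R + delta <= Z g t.
Proof.
move=> hg rt; rewrite /desc_weight big_mkcond (bigD1_seq r) ?iota_uniq //=;
  last by rewrite mem_index_iota; lia.
rewrite is_desc_root -[leLHS]addr0 lerD //; first exact: old_weight_ge hg rt.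
rewrite big_nat_cond; apply: sumr_ge0 => x /andP[/andP[x1 xt] _].
case: ifP => // _.
by apply: le_trans (old_weight_ge (x := x) hg _); [exact: ltW min_weight_gt0 | lia].
Qed.

Lemma nondesc_weight_ge0 (t k : nat) (g : multigraph) : hinv t k g ->
  0 <= N g t.
Proof.
move=> hg; rewrite /nondesc_weight big_nat_cond.
apply: sumr_ge0 => x /andP[/andP[x1 xt] _].
by apply: le_trans (old_weight_ge (x := x) hg _); [exact: ltW min_weight_gt0 | lia].
Qed.

(** The conditional expectation of f after the next edge, given the current graph [g]. *)
Definition attach_step (t k : nat) (f : multigraph -> R) (g : multigraph) : R :=
  \sum_(1 <= x < t.+2) attach_prob m delta g t k.+1 x * f (rcons g (t.+1, x)).

Lemma attach_prob_ge0 (t k x : nat) (g : multigraph) : (0 < t)%N -> (k < m)%N ->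
  hinv t k g -> 0 <= attach_prob m delta g t k.+1 x.
Proof.
move=> t0 km hg; have := denom_bounds t km => /andP[dt _].
have /andP[l0 _] := loop_weight_bounds km hg.
have t1 : 1 <= t%:R :> R by rewrite ler1n.
have m2 := m_ge2; have md := min_weight_gt0.
have d0 : 0 <= denom t k by apply: le_trans dt; nra.
rewrite /attach_prob -/(denom t k) -/(loop_weight k g t).
case: ifP => xt.
  rewrite divr_ge0 //; apply: le_trans (old_weight_ge hg xt).
  exact: ltW min_weight_gt0.
by case: ifP => // /eqP ->; rewrite divr_ge0.
Qed.

(** The endpoints fall into three classes, descendants, non-descendants and the loop, with total
    weights Z, N and [loop_weight]; f is bounded by a constant on each. *)
Lemma attach_step_le (t k : nat) (f : multigraph -> R) (g : multigraph)
    (fD fN fL : R) : (0 < t)%N -> (k < m)%N -> hinv t k g ->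
  (forall x, (1 <= x <= t)%N -> desc g x -> f (rcons g (t.+1, x)) <= fD) ->
  (forall x, (1 <= x <= t)%N -> ~~ desc g x -> f (rcons g (t.+1, x)) <= fN) ->
  f (rcons g (t.+1, t.+1)) <= fL ->
  attach_step t k f g <=
    (Z g t * fD + N g t * fN + loop_weight k g t * fL) / denom t k.
Proof.
move=> t0 km hg hD hN hL; rewrite /attach_step big_nat_recr //=.
apply: le_trans (_ : \sum_(1 <= x < t.+1) attach_prob m delta g t k.+1 x *
  (if desc g x then fD else fN) + attach_prob m delta g t k.+1 t.+1 * fL <= _).
  apply: lerD; last by rewrite ler_wpM2l // attach_prob_ge0.
  rewrite !big_nat; apply: ler_sum => x xt.
  rewrite ler_wpM2l ?attach_prob_ge0 //; case: ifP => dx; first exact: hD.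
  by apply: hN => //; rewrite dx.
rewrite (eq_big_nat _ _ (F2 := fun x => (denom t k)^-1 * (((degree g x)%:R + delta) *
  (if desc g x then fD else fN)))); last first.
  by move=> x xt; rewrite /attach_prob -/(denom t k) xt mulrAC mulrC.
rewrite -mulr_sumr (bigID (desc g)) /=.
rewrite (eq_bigr (fun x => ((degree g x)%:R + delta) * fD)); last by move=> x ->.
rewrite [X in _ * (_ + X)](eq_bigr (fun x => ((degree g x)%:R + delta) * fN));
  last by move=> x /negbTE ->.
rewrite -!mulr_suml -/(Z g t) -/(N g t) /attach_prob ltnn andbF eqxx.
rewrite -/(denom t k) -/(loop_weight k g t).
by rewrite le_eqVlt; apply/orP; left; apply/eqP; ring.
Qed.

(** The conditional expectation of f after j further edges, by the tower rule. For k = 0 and j = m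
    it is the expectation at G(t+1) given G(t). *)
Fixpoint attach_steps (t k j : nat) (f : multigraph -> R) : multigraph -> R :=
  if j is j'.+1 then attach_step t k (attach_steps t k.+1 j' f) else f.

Lemma attach_stepsD (t k j : nat) (f h : multigraph -> R) (g : multigraph) :
  attach_steps t k j (fun g => f g + h g) g =
  attach_steps t k j f g + attach_steps t k j h g.
Proof.
elim: j k g => //= j IH k g; rewrite /attach_step -big_split /=.
by apply: eq_bigr => x _; rewrite IH mulrDr.
Qed.

Lemma attach_stepsZ (t k j : nat) (c : R) (f : multigraph -> R) (g : multigraph) :
  attach_steps t k j (fun g => c * f g) g = c * attach_steps t k j f g.
Proof.
elim: j k g => //= j IH k g; rewrite /attach_step mulr_sumr.
by apply: eq_bigr => x _; rewrite IH mulrCA.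
Qed.

Lemma rate_gt0 : 2 < B.
Proof.
have := min_weight_gt0; have := m_ge2; lra.
Qed.

Lemma attach_step_mono (t k : nat) (f h : multigraph -> R) (g : multigraph) :
  (0 < t)%N -> (k < m)%N -> hinv t k g ->
  (forall x, (1 <= x <= t.+1)%N ->
    f (rcons g (t.+1, x)) <= h (rcons g (t.+1, x))) ->
  attach_step t k f g <= attach_step t k h g.
Proof.
move=> t0 km hg fh; rewrite /attach_step !big_nat; apply: ler_sum => x xt.
by rewrite ler_wpM2l ?fh //; exact: attach_prob_ge0.
Qed.

(** The invariant [I] is carried along each insertion, so f and h need only be compared on graphs
    reachable from [g]. *)
Lemma attach_steps_mono (t k j : nat) (f h : multigraph -> R)
    (I : nat -> multigraph -> Prop) (g : multigraph) :
  (0 < t)%N -> (k + j <= m)%N -> hinv t k g -> I k g ->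
  (forall k g x, (k < m)%N -> hinv t k g -> I k g -> (1 <= x <= t.+1)%N ->
    I k.+1 (rcons g (t.+1, x))) ->
  (forall g, hinv t (k + j)%N g -> I (k + j)%N g -> f g <= h g) ->
  attach_steps t k j f g <= attach_steps t k j h g.
Proof.
move=> t0 + + + IS; elim: j k g => [|j IH] k g kj hg Ig fh /=.
  by apply: fh; rewrite addn0.
apply: attach_step_mono => //; first by lia.
move=> x xt; apply: IH; rewrite ?addSnnS //; first exact: history_inv_rcons.
by apply: IS => //; lia.
Qed.

Lemma attach_steps_geometric (t : nat) (rho : R) (f : multigraph -> R) :
  (0 < t)%N -> 0 <= rho ->
  (forall k g, (k < m)%N -> hinv t k g -> attach_step t k f g <= rho * f g) ->
  forall j k g, (k + j <= m)%N -> hinv t k g ->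
  attach_steps t k j f g <= rho ^+ j * f g.
Proof.
move=> t0 rho0 fS; elim => [|j IH] k g kj hg /=; first by rewrite expr0 mul1r.
apply: le_trans (_ : attach_step t k (fun g => rho ^+ j * f g) g <= _).
  apply: attach_step_mono => //; first by lia.
  by move=> x xt; apply: IH; rewrite ?addSnnS //; exact: history_inv_rcons.
have -> : attach_step t k (fun g => rho ^+ j * f g) g = rho ^+ j * attach_step t k f g.
  exact: (attach_stepsZ t k 1).
by rewrite exprSr -mulrA ler_wpM2l ?exprn_ge0 // fS //; lia.
Qed.

Lemma edge_rate (t k : nat) (g : multigraph) : (0 < t)%N -> (k < m)%N ->
  hinv t k g ->
  [/\ 0 < B * t%:R, B * t%:R <= denom t k <= B * t%:R + C1,
      0 <= loop_weight k g t <= C1 &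
      Z g t + N g t + loop_weight k g t = denom t k].
Proof.
move=> t0 km hg; split; last exact: denom_total.
- by rewrite mulr_gt0 ?ltr0n //; have := rate_gt0; lra.
- exact: denom_bounds.
- exact: loop_weight_bounds.
Qed.

(** * Growth of the weights and drift of 1/Z *)

Lemma attach_step_nondesc (t k : nat) (g : multigraph) : (0 < t)%N -> (k < m)%N ->
  hinv t k g -> attach_step t k (fun g => N g t) g <= (1 + (B * t%:R)^-1) * N g t.
Proof.
move=> t0 km hg; have [W0 /andP[dW _] _ tot] := edge_rate t0 km hg.
have N0 := nondesc_weight_ge0 hg.
apply: le_trans (attach_step_le
  (fD := N g t) (fN := N g t + 1) (fL := N g t) t0 km hg _ _ _) _.
- by move=> x xt dx; rewrite nondesc_weight_rcons ?dx ?andbF ?addr0 //; lia.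
- by move=> x xt dx; rewrite nondesc_weight_rcons ?dx; [case/andP: xt => _ -> | lia].
- by rewrite nondesc_weight_rcons ?ltnn ?addr0 //=.
have d0 : 0 < denom t k by apply: lt_le_trans dW.
rewrite ler_pdivrMr // -tot.
have : 1 <= (B * t%:R)^-1 * (Z g t + N g t + loop_weight k g t).
  by rewrite tot mulrC ler_pdivlMr // mul1r.
nra.
Qed.

Lemma attach_step_desc (t k : nat) (g : multigraph) : (0 < t)%N -> (k < m)%N ->
  (1 <= r <= t)%N -> hinv t k g ->
  attach_step t k (fun g => Z g t) g <= (1 + (B * t%:R)^-1) * Z g t.
Proof.
move=> t0 km rt hg; have [W0 /andP[dW _] _ tot] := edge_rate t0 km hg.
have Zge := desc_weight_ge hg rt.
have w0 := min_weight_gt0.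
apply: le_trans (attach_step_le
  (fD := Z g t + 1) (fN := Z g t) (fL := Z g t) t0 km hg _ _ _) _.
- by move=> x xt dx; rewrite desc_weight_rcons ?dx; [case/andP: xt => _ -> | lia].
- by move=> x xt dx; rewrite desc_weight_rcons ?(negbTE dx) ?andbF ?addr0 //; lia.
- by rewrite desc_weight_rcons ?ltnn ?addr0 //=.
have d0 : 0 < denom t k by apply: lt_le_trans dW.
rewrite ler_pdivrMr // -tot.
have : 1 <= (B * t%:R)^-1 * (Z g t + N g t + loop_weight k g t).
  by rewrite tot mulrC ler_pdivlMr // mul1r.
nra.
Qed.

Definition growth_rate : R := (m%:R + delta) / ((m%:R + delta + 1) * (B + C1)).

Lemma growth_rate_bounds : 0 < growth_rate <= 1.
Proof.
have w0 := min_weight_gt0; have B0 := rate_gt0.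
have C0 : 0 <= C1 by rewrite addr_ge0 ?mulr_ge0.
rewrite /growth_rate divr_gt0 ?mulr_gt0 //=; try lra.
by rewrite ler_pdivrMr ?mulr_gt0 //; nra.
Qed.

(** With D = [denom t k], 1/z becomes 1/(z+1) with probability z/D, an expected relative decrease of
    z/((z+1) D). The constant [growth_rate] comes from z >= m + delta and D <= (B + C1) t. *)
Lemma attach_step_inv_desc (t k : nat) (g : multigraph) : (0 < t)%N -> (k < m)%N ->
  (1 <= r <= t)%N -> hinv t k g ->
  attach_step t k (fun g => (Z g t)^-1) g <= (1 - growth_rate / t%:R) * (Z g t)^-1.
Proof.
move=> t0 km rt hg; have [W0 /andP[dW dW'] _ tot] := edge_rate t0 km hg.
have Zge := desc_weight_ge hg rt.
have w0 := min_weight_gt0.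
apply: le_trans (attach_step_le
  (fD := (Z g t + 1)^-1) (fN := (Z g t)^-1) (fL := (Z g t)^-1) t0 km hg _ _ _) _.
- by move=> x xt dx; rewrite desc_weight_rcons ?dx; [case/andP: xt => _ -> | lia].
- by move=> x xt dx; rewrite desc_weight_rcons ?(negbTE dx) ?andbF ?addr0 //; lia.
- by rewrite desc_weight_rcons ?ltnn ?addr0 //=.
have d0 : 0 < denom t k by apply: lt_le_trans dW.
have t1 : 1 <= t%:R :> R by rewrite ler1n.
have B0 := rate_gt0.
have C0 : 0 <= C1 by rewrite addr_ge0 ?mulr_ge0.
set z := Z g t in Zge tot *; set D := denom t k in d0 dW dW' tot *.
have z0 : 0 < z by lra.
have Nz : N g t + loop_weight k g t = D - z by rewrite -tot; ring.
have -> : (z / (z + 1) + N g t / z + loop_weight k g t / z) / D =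
  (1 - z / ((z + 1) * D)) * z^-1.
  by rewrite -addrA -mulrDl Nz; field; do ?[apply/andP; split]; apply: lt0r_neq0; lra.
rewrite ler_wpM2r ?invr_ge0 ?(ltW z0) // lerD2l lerN2 /growth_rate.
set q := m%:R + delta in w0 Zge *.
have -> : q / ((q + 1) * (B + C1)) / t%:R = q / (q + 1) * ((B + C1) * t%:R)^-1.
  by field; do ?[apply/andP; split]; apply: lt0r_neq0; lra.
have -> : z / ((z + 1) * D) = z / (z + 1) * D^-1.
  by field; do ?[apply/andP; split]; apply: lt0r_neq0; lra.
apply: ler_pM; rewrite ?divr_ge0 ?invr_ge0 ?mulr_ge0 //; try lra.
  rewrite ler_pdivrMr; last lra.
  by rewrite mulrAC ler_pdivlMr; nra.
by rewrite lef_pV2 ?posrE ?mulr_gt0 //; nra.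
Qed.

(** Each of the m edges contributes a contraction factor, of which one is kept; counting t+1 at the
    end can only decrease 1/Z. *)
Lemma inv_desc_drift (t : nat) (g : multigraph) : (1 <= r <= t)%N ->
  history_inv t 0 g ->
  attach_steps t 0 m (fun g => (Z g t.+1)^-1) g <=
    (1 - growth_rate / t%:R) * (Z g t)^-1.
Proof.
move=> rt hg; have t0 : (0 < t)%N by lia.
have w0 := min_weight_gt0; have /andP[c0 c1] := growth_rate_bounds.
have t1 : 1 <= t%:R :> R by rewrite ler1n.
have rho1 : 0 <= growth_rate / t%:R by rewrite divr_ge0 ?ltW //; lra.
have rho0 : 0 <= 1 - growth_rate / t%:R by rewrite subr_ge0 ler_pdivrMr; lra.
have Z0 (h : multigraph) k : history_inv t k h -> 0 < Z h t.
  by move=> hh; apply: lt_le_trans (desc_weight_ge hh rt); lra.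
apply: le_trans (_ : attach_steps t 0 m (fun g => (Z g t)^-1) g <= _).
  apply: (attach_steps_mono (I := fun _ _ => True)) => // h.
  rewrite add0n => hh _.
  have nd := history_new_degree hh.
  rewrite lef_pV2 ?posrE ?(Z0 _ _ hh) //; last first.
    apply: lt_le_trans (desc_weight_ge (history_inv_next hh) _); lia || lra.
  rewrite desc_weightS lerDl; case: ifP => // _.
  by apply: le_trans (ltW w0) _; rewrite lerD2r ler_nat; lia.
apply: le_trans (_ : (1 - growth_rate / t%:R) ^+ m * (Z g t)^-1 <= _).
  apply: attach_steps_geometric => // k h km hh.
  exact: attach_step_inv_desc.
rewrite ler_wpM2r ?invr_ge0 ?(ltW (Z0 _ _ hg)) //.
have -> : m = m.-1.+1 by lia.
rewrite exprS -[leRHS]mulr1 ler_wpM2l // exprn_ile1 //; lra.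
Qed.

(** * Drift of the ratio N/Z *)

Definition new_nondesc_weight (t : nat) (g : multigraph) : R :=
  if desc g t.+1 then 0 else (degree g t.+1)%:R + delta.

(* While no edge of t+1 has hit a descendant, each further edge misses them with
   probability at most p and is a loop with probability at most C1 / (B t). *)
Lemma new_nondesc_weight_le (t j k : nat) (g : multigraph) (z p : R) :
  (1 <= r <= t)%N -> (k + j = m)%N -> history_inv t k g -> 0 <= z <= B * t%:R ->
  (~~ desc g t.+1 -> Z g t = z) ->
  p = (B * t%:R + C1 - z) / (B * t%:R + C1) ->
  attach_steps t k j (new_nondesc_weight t) g <=
  if desc g t.+1 then 0 else
    (m%:R + delta + ((degree g t.+1)%:R - k%:R)) * p ^+ j
    + j%:R * (C1 / (B * t%:R)) * p ^+ j.-1.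
Proof.
move=> rt kj hg /andP[z0 zW] Zg pE; have t0 : (0 < t)%N by lia.
have rtt : (r <= t)%N by case/andP: rt.
have w0 := min_weight_gt0.
have C0 : 0 <= C1 by rewrite addr_ge0 ?mulr_ge0.
have W0 : 0 < B * t%:R by rewrite mulr_gt0 ?ltr0n //; have := rate_gt0; lra.
have p0 : 0 <= p by rewrite pE divr_ge0 //; lra.
elim: j k kj g hg Zg => [|j IH] k kj g hg Zg /=.
  rewrite /new_nondesc_weight; case: ifP => // _.
  by rewrite -kj addn0 expr0 !mul0r; lra.
have km : (k < m)%N by rewrite -kj addnS ltnS leq_addr.
have kj' : (k.+1 + j = m)%N by rewrite addSnnS.
have [W0' /andP[dW dW'] /andP[l0 lC] tot] := edge_rate t0 km hg.
have d0 : 0 < denom t k by apply: lt_le_trans dW.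
case: (boolP (desc g t.+1)) => dg.
  have H x : (1 <= x <= t.+1)%N ->
      attach_steps t k.+1 j (new_nondesc_weight t) (rcons g (t.+1, x)) <= 0.
    move=> xt; apply: le_trans (IH _ kj' _ (history_inv_rcons hg xt) _) _;
      by rewrite is_desc_rcons_new // dg.
  apply: le_trans (attach_step_le (fD := 0) (fN := 0) (fL := 0) t0 km hg _ _ _) _.
  - by move=> x /andP[x1 xt] _; apply: H; rewrite x1 leqW.
  - by move=> x /andP[x1 xt] _; apply: H; rewrite x1 leqW.
  - by apply: H; rewrite /= ltnS.
  by rewrite !mulr0 !addr0 mul0r.
have {}Zg := Zg dg.
(* In the process, [l] is the number of loops among the first k edges of t+1. *)
set l : R := (degree g t.+1)%:R - k%:R.
set A := (m%:R + delta + l) * p ^+ j + j%:R * (C1 / (B * t%:R)) * p ^+ j.-1.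
have l_ge0 : 0 <= l by rewrite subr_ge0 ler_nat; case/andP: (history_new_degree hg).
have A0 : 0 <= A.
  by rewrite addr_ge0 ?mulr_ge0 ?exprn_ge0 ?invr_ge0 ?(ltW W0) //; lra.
(* A descendant endpoint brings the value to 0, a non-descendant leaves [l] unchanged, and a loop
   raises [l] by one, which adds p^j. *)
apply: le_trans (attach_step_le (fD := 0) (fN := A) (fL := A + p ^+ j)
  t0 km hg _ _ _) _.
- move=> x xt dx; have xt' : (1 <= x <= t.+1)%N by case/andP: xt => -> /leqW.
  have dn : desc (rcons g (t.+1, x)) t.+1.
    by rewrite is_desc_rcons_new // dx; case/andP: xt => _ ->; rewrite orbT.
  by apply: le_trans (IH _ kj' _ (history_inv_rcons hg xt') _) _; rewrite dn.
- move=> x xt dx; have xt' : (1 <= x <= t.+1)%N by case/andP: xt => -> /leqW.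
  have dn : desc (rcons g (t.+1, x)) t.+1 = false.
    by rewrite is_desc_rcons_new // (negbTE dx) (negbTE dg) andbF.
  apply: le_trans (IH _ kj' _ (history_inv_rcons hg xt') _) _; rewrite dn.
    by rewrite desc_weight_rcons // (negbTE dx) andbF addr0.
  rewrite degree_rcons eqxx (_ : x == t.+1 = false); last first.
    by case/andP: xt => _ xt; rewrite ltn_eqF.
  rewrite /A lerD2r ler_wpM2r ?exprn_ge0 // -[k.+1]addn1 !natrD.
  by rewrite /l /=; lra.
- have xt' : (1 <= t.+1 <= t.+1)%N by rewrite /= ltnS.
  have dn : desc (rcons g (t.+1, t.+1)) t.+1 = false.
    by rewrite is_desc_rcons_new // ltnn (negbTE dg).
  apply: le_trans (IH _ kj' _ (history_inv_rcons hg xt') _) _; rewrite dn.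
    by rewrite desc_weight_rcons // ltnn addr0.
  have -> : A + p ^+ j = (m%:R + delta + (l + 1)) * p ^+ j
      + j%:R * (C1 / (B * t%:R)) * p ^+ j.-1 by rewrite /A; ring.
  rewrite degree_rcons eqxx lerD2r ler_wpM2r ?exprn_ge0 // -[k.+1]addn1 !natrD.
  by rewrite /l /=; lra.
(* The probability of missing the descendants increases with the denominator, which is at most B t +
   C1. *)
have dp : (denom t k - Z g t) / denom t k <= p.
  rewrite ler_pdivrMr // pE Zg mulrAC ler_pdivlMr; last lra.
  by have := ler_wpM2l z0 dW'; lra.
have lu : loop_weight k g t / denom t k <= C1 / (B * t%:R).
  by apply: ler_pM => //; [rewrite invr_ge0 ltW | rewrite lef_pV2 ?posrE].
have -> : (Z g t * 0 + N g t * A + loop_weight k g t * (A + p ^+ j)) / denom t k =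
  A * ((denom t k - Z g t) / denom t k) + loop_weight k g t / denom t k * p ^+ j.
  by rewrite -tot; ring.
apply: le_trans (lerD (ler_wpM2l A0 dp) (ler_wpM2r (exprn_ge0 j p0) lu)) _.
rewrite /A mulrDl -!mulrA -exprSr -addrA lerD2l.
(* At j = 0 the truncated exponent gives p instead of p^0, but there the coefficient j vanishes. *)
have -> : p ^+ j.-1 * p = (if j is 0 then p else p ^+ j).
  by case: (j) => [|i] //=; rewrite ?expr0 ?mul1r // -exprSr.
case: (j) => [|i]; first by rewrite !mul0r add0r mul1r.
by rewrite -[i.+2]addn1 natrD; lra.
Qed.

Lemma attach_step_cst (t k : nat) (c : R) (g : multigraph) : (0 < t)%N ->
  (k < m)%N -> history_inv t k g -> attach_step t k (fun=> c) g <= 1 * c.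
Proof.
move=> t0 km hg; have [W0 /andP[dW _] _ tot] := edge_rate t0 km hg.
apply: le_trans (attach_step_le (fD := c) (fN := c) (fL := c) t0 km hg _ _ _) _ => //.
rewrite -!mulrDl tot mul1r mulrAC mulfV ?mul1r // lt0r_neq0 //.
exact: lt_le_trans dW.
Qed.

Lemma attach_steps_cst (t k j : nat) (c : R) (g : multigraph) : (0 < t)%N ->
  (k + j <= m)%N -> history_inv t k g -> attach_steps t k j (fun=> c) g <= c.
Proof.
move=> t0 kj hg; rewrite -[leRHS]mul1r -[X in X * _](expr1n _ j).
apply: (attach_steps_geometric (f := fun=> c)) => // i h im hh.
exact: attach_step_cst.
Qed.

(* Here g0 is G(t) and g is g0 with some edges of vertex t+1 added. *)
Definition block_inv (t : nat) (g0 : multigraph) (k : nat) (g : multigraph) : Prop :=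
  N g0 t <= N g t /\ Z g0 t + (desc g t.+1)%:R <= Z g t.

(** Vertex t+1 becomes a descendant only through an edge that also raises Z by 1. *)
Lemma block_inv_rcons (t k x : nat) (g0 g : multigraph) : (r <= t)%N ->
  (1 <= x <= t.+1)%N -> block_inv t g0 k g ->
  block_inv t g0 k.+1 (rcons g (t.+1, x)).
Proof.
move=> rt xt [iN iZ]; split.
  by rewrite nondesc_weight_rcons // (le_trans iN) // lerDl.
rewrite desc_weight_rcons // is_desc_rcons_new //.
rewrite -(lerD2r ((x <= t)%N && desc g x)%:R) in iZ.
apply: le_trans iZ; rewrite -addrA lerD2l -natrD ler_nat.
by case: (desc g t.+1); case: (_ && _).
Qed.

Lemma fresh_degree (t : nat) (g : multigraph) :
  history_inv t 0 g -> degree g t.+1 = 0%N.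
Proof. by case=> _ _ _ /andP[_]; rewrite muln0 leqn0 => /eqP. Qed.

Lemma total_weight0 (t : nat) (g : multigraph) :
  history_inv t 0 g -> N g t + Z g t = B * t%:R.
Proof.
move=> hg; have := total_weight hg.
by rewrite fresh_degree // mulr0 !addr0 addrC.
Qed.

(** This is [ratio_increment] with a the growth of Z on [t] and c = 1 + C1. If t+1 joins the
    descendants, it brings weight at most C1, and then a >= 1 by [block_inv], so C1 a absorbs that
    weight. *)
Lemma ratio_block_le (t : nat) (g0 g : multigraph) : (1 <= r <= t)%N ->
  history_inv t 0 g0 -> history_inv t m g -> block_inv t g0 m g ->
  N g t.+1 / Z g t.+1 <= N g0 t / Z g0 t - B * N g0 t / Z g0 t ^+ 2
    + B * t%:R / Z g0 t ^+ 2 * (N g t + new_nondesc_weight t g - N g0 t)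
    + B * N g0 t * (1 + C1) / Z g0 t ^+ 3 * (Z g t - Z g0 t).
Proof.
move=> rt hg0 hg [iN iZ].
have hg1 := history_inv_next hg.
have tot1 := total_weight0 hg1; have tot0 := total_weight0 hg0.
have /andP[nd1 nd2] := history_new_degree hg.
have {}nd1 : m%:R <= (degree g t.+1)%:R :> R by rewrite ler_nat.
have {}nd2 : (degree g t.+1)%:R <= 2 * m%:R :> R by rewrite -natrM ler_nat.
have Zge := desc_weight_ge hg0 rt.
have N0 := nondesc_weight_ge0 hg0.
have w0 := min_weight_gt0; have B0 := rate_gt0.
have NS : N g t.+1 = N g t + new_nondesc_weight t g by rewrite nondesc_weightS.
have F0 : 0 <= new_nondesc_weight t g.
  by rewrite /new_nondesc_weight; case: ifP => // _; lra.
rewrite -NS; apply: ratio_increment.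
- lra.
- by [].
- by rewrite N0 NS; lra.
- rewrite desc_weightS; move: iZ; case: ifP => _ /= iZ; apply/andP; split; lra.
- by [].
- by rewrite tot1 -[t.+1]addn1 natrD.
rewrite desc_weightS; move: iZ; case: ifP => _ /= iZ.
  have dn := ler_norm delta.
  have dn0 := normr_ge0 delta.
  have m2 := m_ge2.
  have : C1 * 1 <= C1 * (Z g t - Z g0 t) by rewrite ler_wpM2l //; lra.
  by lra.
have : 0 <= C1 * (Z g t - Z g0 t).
  by apply: mulr_ge0; [rewrite addr_ge0 ?mulr_ge0 | lra].
lra.
Qed.

Lemma ratio_step_le (t : nat) (g : multigraph) (lam p : R) : (1 <= r <= t)%N ->
  history_inv t 0 g ->
  lam = (1 + (B * t%:R)^-1) ^+ m - 1 ->
  p = (B * t%:R + C1 - Z g t) / (B * t%:R + C1) ->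
  attach_steps t 0 m (fun g => N g t.+1 / Z g t.+1) g <=
    N g t / Z g t - B * N g t / Z g t ^+ 2
    + B * t%:R / Z g t ^+ 2 * (N g t * lam + (m%:R + delta) * p ^+ 2
        + m%:R * (C1 / (B * t%:R)) * p)
    + B * N g t * (1 + C1) / Z g t ^+ 3 * (Z g t * lam).
Proof.
move=> rt hg lamE pE; have t0 : (0 < t)%N by lia.
have rtt : (r <= t)%N by lia.
have m1 : (m = m.-2.+2)%N by lia.
have Zge := desc_weight_ge hg rt.
have N0 := nondesc_weight_ge0 hg.
have w0 := min_weight_gt0; have B0 := rate_gt0.
have C0 : 0 <= C1 by rewrite addr_ge0 ?mulr_ge0.
have W0 : 0 < B * t%:R by rewrite mulr_gt0 ?ltr0n //; lra.
have tot := total_weight0 hg.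
set n := N g t in N0 tot *; set z := Z g t in Zge tot pE *.
have z0 : 0 < z by lra.
set c1 := B * t%:R / z ^+ 2; set c3 := B * n * (1 + C1) / z ^+ 3.
have c10 : 0 <= c1 by rewrite divr_ge0 ?exprn_ge0 ?(ltW W0) ?(ltW z0).
have c30 : 0 <= c3.
  by rewrite divr_ge0 ?exprn_ge0 ?mulr_ge0 ?(ltW z0) //; lra.
(* [c0] collects the terms fixed by G(t), leaving a linear combination of three quantities whose
   expectations are bounded separately. *)
pose c0 := n / z - B * n / z ^+ 2 - c1 * n - c3 * z.
apply: le_trans (_ : attach_steps t 0 m (fun h => c0 + (c1 * N h t +
  (c1 * new_nondesc_weight t h + c3 * Z h t))) g <= _).
  apply: (attach_steps_mono (I := block_inv t g)) => //.
  - by split; rewrite // is_desc_new // addr0.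
  - by move=> k h x km hh ih xt; exact: block_inv_rcons.
  move=> h; rewrite add0n => hh ih.
  by have := ratio_block_le rt hg hh ih; rewrite -/n -/z -/c1 -/c3 /c0; lra.
rewrite (attach_stepsD t 0 m (fun=> c0)) (attach_stepsD t 0 m (fun h => c1 * N h t)).
rewrite (attach_stepsD t 0 m (fun h => c1 * new_nondesc_weight t h)).
rewrite !attach_stepsZ.
have lam0 : 0 <= 1 + (B * t%:R)^-1 by rewrite addr_ge0 // invr_ge0 ltW.
have e0 : attach_steps t 0 m (fun=> c0) g <= c0 by exact: attach_steps_cst.
have e1 : attach_steps t 0 m (fun h => N h t) g <= (1 + lam) * n.
  rewrite lamE addrC subrK.
  apply: (attach_steps_geometric (f := fun h => N h t)) => // k h km hh.
  exact: attach_step_nondesc.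
have e3 : attach_steps t 0 m (fun h => Z h t) g <= (1 + lam) * z.
  rewrite lamE addrC subrK.
  apply: (attach_steps_geometric (f := fun h => Z h t)) => // k h km hh.
  exact: attach_step_desc.
have p01 : 0 <= p <= 1.
  rewrite pE divr_ge0 /=; [|lra|lra].
  by rewrite ler_pdivrMr ?mul1r; lra.
have e2 : attach_steps t 0 m (new_nondesc_weight t) g <=
    (m%:R + delta) * p ^+ 2 + m%:R * (C1 / (B * t%:R)) * p.
  apply: le_trans (new_nondesc_weight_le rt (add0n m) hg _ _ pE) _ => //.
    by apply/andP; split; lra.
  rewrite is_desc_new //.
  rewrite fresh_degree //.
  case/andP: p01 => p0 p1; rewrite subrr addr0; apply: lerD.
    (* Here m > 1 enters: p^m <= p^2. *)
    rewrite ler_wpM2l ?(ltW w0) // m1 -[m.-2.+2]addn2 exprD.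
    by rewrite -[leRHS]mul1r ler_wpM2r ?exprn_ge0 // exprn_ile1.
  rewrite ler_wpM2l ?mulr_ge0 ?invr_ge0 ?(ltW W0) // m1 /= exprSr.
  by rewrite -[leRHS]mul1r ler_wpM2r // exprn_ile1.
apply: le_trans (lerD e0 (lerD (ler_wpM2l c10 e1) (lerD (ler_wpM2l c10 e2)
  (ler_wpM2l c30 e3)))) _.
by rewrite /c0; lra.
Qed.

Lemma ratio_drift : exists K eps C : R, [/\ 0 < eps <= 1, 0 <= C &
  forall t g, (1 <= r <= t)%N -> history_inv t 0 g -> K <= Z g t ->
  attach_steps t 0 m (fun g => N g t.+1 / Z g t.+1) g <=
    (1 - eps / t%:R) * (N g t / Z g t) + C / t%:R ^+ 2].
Proof.
have w0 := min_weight_gt0; have B0 := rate_gt0; have m2 := m_ge2.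
have C0 : 0 <= C1 by rewrite addr_ge0 ?mulr_ge0.
pose M : R := m%:R; pose q := M + delta; pose C4 : R := 3 ^+ m.
pose C6 := (M + q) * C1 ^+ 2.
pose C7 := C4 + 2 * q * C1 + M * C1 + (M + q) * (1 + C1) * (M + C4).
have BE : B = M + q by rewrite /M /q; lra.
have q0 : 0 < q by [].
have C40 : 0 <= C4 by rewrite exprn_ge0.
have C60 : 0 <= C6 by rewrite mulr_ge0 ?exprn_ge0 // -BE; lra.
have C70 : 0 <= C7.
  have M0 : 0 <= M by []; rewrite /C7; clearbody q M C4.
  have {}q0 := ltW q0.
  by rewrite !addr_ge0 ?mulr_ge0 ?addr_ge0.
(* For Z >= K the error (C7 + C6)/(Z W) is at most half of the drift q/W, where W = B t; the other
   half is eps/t. The summand 1 in K ensures Z >= 1. *)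
exists (1 + 2 * (C7 + C6) / q), (q / (2 * B)), (C6 / B ^+ 2); split.
- rewrite divr_gt0 //=; last lra.
  by rewrite ler_pdivrMr /M; lra.
- by rewrite divr_ge0 ?exprn_ge0 //; lra.
move=> t g rt hg Zg.
have t1 : 1 <= t%:R :> R by rewrite ler1n; lia.
have W1 : 1 <= B * t%:R by nra.
have tot := esym (total_weight0 hg).
have N0 := nondesc_weight_ge0 hg.
have K1 : 1 <= Z g t.
  by apply: le_trans Zg; rewrite lerDl divr_ge0 ?mulr_ge0 //; lra.
have W01 : 0 <= (B * t%:R)^-1 <= 1.
  by rewrite invr_ge0 invf_le1; [apply/andP; split|]; lra.
have lamW : (1 + (B * t%:R)^-1) ^+ m - 1 <= M / (B * t%:R) + C4 / (B * t%:R) ^+ 2.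
  by rewrite -exprVn; have := expr1D_le m W01; rewrite -/M -/C4; lra.
have := ratio_step_le rt hg erefl erefl.
set W := B * t%:R in tot W1 W01 lamW *; rewrite [X in X * N g t]BE => stepW.
apply: le_trans stepW _.
apply: le_trans (ratio_drift_bound N0 K1 tot _ _ C0 C40 lamW erefl erefl erefl) _.
- by rewrite /M; lra.
- exact: ltW.
rewrite -/C7 -/C6 /W.
have Vz : 0 <= N g t / Z g t by rewrite divr_ge0 //; lra.
have -> : C6 / B ^+ 2 / t%:R ^+ 2 = C6 / (B * t%:R) ^+ 2.
  by field; do ?[apply/andP; split]; apply: lt0r_neq0; lra.
rewrite lerD2r [leRHS]mulrC ler_wpM2l // -addrA lerD2l.
have zW : (C7 + C6) / (Z g t * (B * t%:R)) <= q / 2 / (B * t%:R).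
  rewrite invfM mulrA ler_wpM2r ?invr_ge0 ?(le_trans ler01 W1) //.
  rewrite ler_pdivrMr; last lra.
  move: Zg; rewrite -lerBrDl ler_pdivrMr //; nra.
have -> : q / (2 * B) / t%:R = q / (B * t%:R) - q / 2 / (B * t%:R).
  by field; do ?[apply/andP; split]; apply: lt0r_neq0; lra.
lra.
Qed.

End Weights.

(** * Histories and their probabilities *)

Section Histories.
Variable m : nat.

(** Enumerating the possible graphs turns expectations into finite sums. For t = 0 the only endpoint
    is 1, so [histories 1] consists of the graph with m loops. *)
Definition extend (t : nat) (l : seq multigraph) : seq multigraph :=
  [seq rcons g (t.+1, x) | g <- l, x <- iota 1 t.+1].

Fixpoint histories (t : nat) : seq multigraph :=
  if t is t'.+1 then iter m (extend t') (histories t') else [:: [::]].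

Definition partial_histories (t k : nat) : seq multigraph :=
  iter k (extend t) (histories t).

Lemma partial_histories_inv (t k : nat) (g : multigraph) :
  g \in partial_histories t k -> history_inv m t k g.
Proof.
have step t' : (forall g, g \in histories t' -> history_inv m t' 0 g) ->
    forall k' g, g \in partial_histories t' k' -> history_inv m t' k' g.
  move=> h0; elim=> [|k' IH] {}g; first exact: h0.
  rewrite /partial_histories iterS => /allpairsPdep[h [x [hh xt ->]]].
  by apply: history_inv_rcons; [exact: IH | rewrite mem_iota in xt; lia].
apply: (step t) => {k} {}g; elim: t g => [|t IH] g.
  rewrite inE => /eqP ->; split => //; first by rewrite /=; lia.
    by move=> x; lia.
  by rewrite /degree big_nil.
by move=> hg; apply: history_inv_next; exact: step hg.
Qed.

Lemma histories_inv (t : nat) (g : multigraph) :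
  g \in histories t -> history_inv m t 0 g.
Proof. exact: (@partial_histories_inv t 0). Qed.

Lemma partial_graphS (v : nat -> nat -> nat) (t k : nat) :
  partial_graph m v t k.+1 = rcons (partial_graph m v t k) (t.+1, v t.+1 k.+1).
Proof. by rewrite /partial_graph -{1}(addn1 k) iotaD map_cat catA /= cats1 add1n. Qed.

Lemma partial_graph_next (v : nat -> nat -> nat) (t : nat) :
  partial_graph m v t.+1 0 = partial_graph m v t m.
Proof.
rewrite /partial_graph cats0 -[in LHS](addn1 t) iotaD map_cat flatten_cat /=.
by rewrite cats0 add1n.
Qed.

Definition admissible (v : nat -> nat -> nat) : Prop :=
  forall s j, (1 <= s)%N -> (1 <= j <= m)%N -> (1 <= v s j <= s)%N.

Lemma partial_graph_history (v : nat -> nat -> nat) (t k : nat) :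
  admissible v -> (k <= m)%N -> partial_graph m v t k \in partial_histories t k.
Proof.
move=> hv; have step t' k' : (k' <= m)%N ->
    partial_graph m v t' 0 \in histories t' ->
    partial_graph m v t' k' \in partial_histories t' k'.
  move=> + h0; elim: k' => [//|k' IH] k'm.
  rewrite partial_graphS /partial_histories iterS; apply: allpairs_f_dep.
    by apply: IH; lia.
  by have := hv t'.+1 k'.+1; rewrite mem_iota; lia.
move=> km; apply: (step t) => //; elim: t => [//|t IH].
by rewrite partial_graph_next; exact: step.
Qed.

End Histories.

(** * Expectations over histories and almost sure bounds *)

Section Expectation.
Variables (d : measure_display) (T : measurableType d) (R : realType).
Variables (P : probability T R) (m : nat) (delta : R) (w : nat -> nat -> T -> nat).
Hypothesis hw : pref_attach P m delta w.

Definition history_event (t k : nat) (g : multigraph) : set T :=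
  [set omega | partial_graph m (fun s j => w s j omega) t k = g].

Definition endpoint_event (s j x : nat) : set T := [set omega | w s j omega = x].

Lemma history_event_rcons (t k x : nat) (g : multigraph) :
  history_event t k.+1 (rcons g (t.+1, x)) =
  history_event t k g `&` endpoint_event t.+1 k.+1 x.
Proof.
apply/seteqP; split => omega; rewrite /history_event /endpoint_event /= partial_graphS.
  by move=> /rcons_inj[-> ->].
by move=> [-> ->].
Qed.

Lemma measurable_endpoint_event (s j x : nat) : (1 <= s)%N -> (1 <= j <= m)%N ->
  measurable (endpoint_event s j x).
Proof.
move=> s1 jm; rewrite (_ : endpoint_event s j x = setT `&` w s j @^-1` [set x]).
  exact: (pa_measurable hw s1 jm measurableT).
by rewrite setTI.
Qed.

(** The event is empty unless the edges of [g] start at the right vertices, and then it is a finite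
    intersection of endpoint events. *)
Lemma measurable_history_event (t k : nat) (g : multigraph) : (k <= m)%N ->
  measurable (history_event t k g).
Proof.
have step t' k' g' : (k' <= m)%N ->
    (forall g, measurable (history_event t' 0 g)) ->
    measurable (history_event t' k' g').
  move=> + h0; elim: k' g' => [//|k' IH] g' k'm.
  case/lastP: g' => [|g' [s x]].
    rewrite (_ : history_event _ _ _ = set0) //.
    apply/seteqP; split => // omega; rewrite /history_event /= partial_graphS.
    by case: (partial_graph _ _ _ _).
  have [->|st] := eqVneq s t'.+1.
    rewrite history_event_rcons; apply: measurableI; first by apply: IH; lia.
    by apply: measurable_endpoint_event; lia.
  rewrite (_ : history_event _ _ _ = set0) //.
  apply/seteqP; split => // omega; rewrite /history_event /= partial_graphS.
  by move=> /rcons_inj[_ e]; rewrite e eqxx in st.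
move=> km; apply: (step t) => //; elim: t => [|t IH] {km}g.
  rewrite /history_event /partial_graph /=.
  have [<-|gn] := eqVneq [::] g.
    by rewrite (_ : [set _ | _] = setT) //; apply/seteqP; split.
  rewrite (_ : [set _ | _] = set0) //; apply/seteqP; split => // omega /=.
  by move=> e; rewrite e eqxx in gn.
rewrite (_ : history_event t.+1 0 g = history_event t m g); first exact: step.
by rewrite /history_event; under eq_set do rewrite partial_graph_next.
Qed.

Definition history_prob (t k : nat) (g : multigraph) : R :=
  fine (P (history_event t k g)).

Lemma history_prob_rcons (t k x : nat) (g : multigraph) : (1 <= t)%N ->
  (k < m)%N -> history_prob t k.+1 (rcons g (t.+1, x)) =
  history_prob t k g * attach_prob m delta g t k.+1 x.
Proof.
move=> t1 km; rewrite /history_prob history_event_rcons.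
rewrite (pa_law hw (i := k.+1) g x t1) ?km // fineM //.
by apply: fin_num_measure; apply: measurable_history_event; lia.
Qed.

Definition expect (t k : nat) (f : multigraph -> R) : R :=
  \sum_(g <- partial_histories m t k) history_prob t k g * f g.

(** The tower rule: [pa_law] factors the probability of each extended history. *)
Lemma expect_step (t k : nat) (f : multigraph -> R) : (1 <= t)%N -> (k < m)%N ->
  expect t k.+1 f = expect t k (attach_step m delta t k f).
Proof.
move=> t1 km; rewrite /expect /partial_histories iterS big_allpairs_dep.
apply: eq_bigr => g _; rewrite mulr_sumr.
by apply: eq_big_seq => x _; rewrite history_prob_rcons // mulrA.
Qed.

Lemma expect_steps (t k j : nat) (f : multigraph -> R) : (1 <= t)%N ->
  (k + j <= m)%N -> expect t (k + j) f = expect t k (attach_steps m delta t k j f).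
Proof.
move=> t1; elim: j k => [|j IH] k kj; first by rewrite addn0.
by rewrite -addSnnS IH ?expect_step //; lia.
Qed.

Lemma expectS (t : nat) (f : multigraph -> R) : (1 <= t)%N ->
  expect t.+1 0 f = expect t 0 (attach_steps m delta t 0 m f).
Proof.
move=> t1; rewrite -expect_steps ?add0n // /expect.
apply: eq_bigr => g _; congr (fine (P _) * _).
by rewrite /history_event; under eq_set do rewrite partial_graph_next.
Qed.

Lemma history_prob_ge0 (t k : nat) (g : multigraph) : 0 <= history_prob t k g.
Proof. exact: fine_ge0. Qed.

Lemma expect_le (t : nat) (f h : multigraph -> R) :
  (forall g, g \in histories m t -> f g <= h g) -> expect t 0 f <= expect t 0 h.
Proof.
move=> fh; rewrite /expect !big_seq; apply: ler_sum => g hg.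
by rewrite ler_wpM2l ?history_prob_ge0 // fh.
Qed.

Lemma expect_ge0 (t : nat) (f : multigraph -> R) :
  (forall g, g \in histories m t -> 0 <= f g) -> 0 <= expect t 0 f.
Proof.
move=> f0; rewrite /expect big_seq; apply: sumr_ge0 => g hg.
by rewrite mulr_ge0 ?history_prob_ge0 // f0.
Qed.

(** After each past, an endpoint outside the range has probability 0. The pairs of a past and an
    endpoint are countable, enumerated by [unpickle], so their bad events have a negligible union.
    Vertex 1 is settled by [pa_init]. *)
Lemma ae_admissible :
  {ae P, forall omega : T, admissible m (fun s j => w s j omega)}.
Proof.
suff H s j : {ae P, forall omega : T,
    (1 <= s)%N -> (1 <= j <= m)%N -> (1 <= w s j omega <= s)%N}.
  have := ae_foralln (fun s => ae_foralln (H s)).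
  by apply: filterS => omega h s j; exact: h.
case: s => [|[|t]]; first exact: aeW.
  by apply: aeW => omega _ jm; rewrite (pa_init hw).
have [jm|jm] := boolP (1 <= j <= m)%N; last exact: aeW.
pose F n := if @unpickle (multigraph * nat)%type n is Some (g, x) then
  if (1 <= x <= t.+2)%N then set0 else
    history_event t.+1 j.-1 g `&` endpoint_event t.+2 j x else set0.
have Fneg : P.-negligible (\bigcup_n F n).
  apply: negligible_bigcup => n; rewrite /F.
  case: unpickle => [[g x]|]; last exact: negligible_set0.
  case: ifPn => xt; first exact: negligible_set0.
  apply/negligibleP.
    apply: measurableI; first by apply: measurable_history_event; lia.
    exact: measurable_endpoint_event.
  apply: etrans (pa_law hw (t := t.+1) g x isT jm) _.
  rewrite /attach_prob ifF; last by apply/negbTE; lia.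
  rewrite ifF ?mule0 //; apply/eqP; lia.
apply: negligibleS Fneg => omega /= /not_implyP[_ /not_implyP[_ /negP h]].
exists (pickle
  (partial_graph m (fun s j => w s j omega) t.+1 j.-1, w t.+2 j omega)) => //.
by rewrite /F pickleK (negbTE h).
Qed.

(** By monotone convergence the full series has expectation at most L, hence is almost surely finite
    and bounds its partial sums. *)
Lemma ae_bounded_partial_sums (F : nat -> multigraph -> R) (L : R) :
  (forall t g, g \in histories m t -> 0 <= F t g) ->
  (forall n, \sum_(0 <= t < n) expect t 0 (F t) <= L) ->
  {ae P, forall omega : T, admissible m (fun s j => w s j omega) ->
    exists L', forall n, \sum_(0 <= t < n) F t (pa_graph m w t omega) <= L'}.
Proof.
move=> F0 FL.
(* On admissible outcomes this dominates F(t, G(t)), and as a sum of indicators it is measurable.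
   The absolute value gives nonnegativity for all [g], while [F0] covers only histories. *)
pose h t omega : \bar R := (\sum_(g <- histories m t)
  (`|F t g|%:E * (\1_(history_event t 0 g) omega)%:E))%E.
have mE t g : measurable (history_event t 0 g) by exact: measurable_history_event.
have h0 t omega : (0 <= h t omega)%E.
  by apply: sume_ge0 => g _; rewrite mule_ge0 ?lee_fin.
have mterm t g : measurable_fun setT ((fun omega =>
    `|F t g|%:E * (\1_(history_event t 0 g) omega)%:E)%E : T -> \bar R).
  apply: measurable_funeM; apply/measurable_EFinP.
  exact: measurable_indic.
have mh t : measurable_fun setT (h t).
  by apply: emeasurable_sum => g; exact: mterm.
have ih t : (\int[P]_omega h t omega = (expect t 0 (F t))%:E)%E.
  rewrite (ge0_integral_sum P measurableT (mterm t)); last first.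
    by move=> g omega _; rewrite mule_ge0 ?lee_fin.
  rewrite /expect -sumEFin; apply: eq_big_seq => g hg.
  rewrite ge0_integralZl_EFin //; last first.
    by apply/measurable_EFinP; exact: measurable_indic.
  rewrite integral_indic // setIT ger0_norm ?F0 // mulrC EFinM fineK //.
  exact: fin_num_measure.
have iS : (\int[P]_omega \sum_(0 <= t <oo) h t omega <= L%:E)%E.
  rewrite integral_nneseries //.
  apply: lime_le; first by apply: is_cvg_nneseries => t _ _; exact: integral_ge0.
  by apply: nearW => n; under eq_bigr do rewrite ih; rewrite sumEFin lee_fin.
have intS : P.-integrable setT (fun omega => \sum_(0 <= t <oo) h t omega)%E.
  apply/integrableP; split.
    by apply: ge0_emeasurable_sum.
  apply: le_lt_trans (ltry L); under eq_integral => omega _.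
    rewrite gee0_abs; last by apply: nneseries_ge0.
  over.
  exact: iS.
apply: filterS (integrable_ae measurableT intS) => omega /(_ I) fS hv.
exists (fine (\sum_(0 <= t <oo) h t omega)%E) => n.
rewrite -lee_fin fineK //.
apply: le_trans (nneseries_lim_ge (P := xpredT) n _); last by move=> *; exact: h0.
rewrite -sumEFin; apply: lee_sum => t _.
have gt := partial_graph_history t hv (leq0n m).
rewrite /h (big_rem _ gt) /= -[leLHS]adde0 leeD //; last first.
  by apply: sume_ge0 => g _; rewrite mule_ge0 ?lee_fin.
rewrite indicE mem_set // mule1 lee_fin; exact: ler_norm.
Qed.

End Expectation.

(** * Recovering an earlier graph from a later one *)

Section Prefix.
Variable m : nat.

Lemma size_partial_graph (v : nat -> nat -> nat) (t k : nat) :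
  size (partial_graph m v t k) = (m * t + k)%N.
Proof.
rewrite /partial_graph size_cat size_map size_iota size_allpairs !size_iota.
by rewrite mulnC.
Qed.

(** Edges are listed in order of insertion and each vertex brings m of them, so the first m n edges
    are G(n). *)
Lemma take_partial_graph (v : nat -> nat -> nat) (n t k : nat) : (n <= t)%N ->
  take (m * n) (partial_graph m v t k) = partial_graph m v n 0.
Proof.
have step t' k' : (n <= t')%N ->
    take (m * n) (partial_graph m v t' k') = take (m * n) (partial_graph m v t' 0).
  move=> nt; elim: k' => // k' IH; rewrite partial_graphS -cats1 takel_cat //.
  rewrite size_partial_graph (leq_trans (_ : _ <= m * t')%N) ?leq_addr //.
  by rewrite leq_mul2l nt orbT.
move=> nt; rewrite step // -(subnKC nt); elim: (t - n)%N => [|i IH].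
  by rewrite addn0 take_oversize // size_partial_graph addn0.
by rewrite addnS partial_graph_next step ?leq_addr.
Qed.

Lemma take_rcons_history (n t k x : nat) (g : multigraph) : (n <= t)%N ->
  history_inv m t k g -> take (m * n) (rcons g (t.+1, x)) = take (m * n) g.
Proof.
move=> nt hg; rewrite -cats1 takel_cat // (history_size hg).
by rewrite (leq_trans (_ : _ <= m * t)%N) ?leq_addr ?leq_mul2l ?nt ?orbT.
Qed.

End Prefix.

(** * Monotonicity of the weights and bounds on counts and degrees *)

Section Monotonicity.
Variables (R : realType) (m : nat) (delta : R) (r : nat).
Hypotheses (m_gt1 : (1 < m)%N) (delta_gt : - m%:R < delta).

(** Edges only add to Z, and a new descendant brings weight at least m + delta. Hence Z stays at
    least K once it has reached K. *)
Lemma desc_weight_prefix_le (n t : nat) (g : multigraph) : (n <= t)%N ->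
  g \in histories m t ->
  desc_weight delta r (take (m * n) g) n <= desc_weight delta r g t.
Proof.
have w0 := ltW (min_weight_gt0 delta_gt).
move=> nt; rewrite -(subnKC nt); elim: (t - n)%N g => [|i IH] g hg.
  rewrite addn0 take_oversize // (history_size (histories_inv hg)); lia.
rewrite addnS in hg; have hp : g \in partial_histories m (n + i) m by exact: hg.
have hi := partial_histories_inv hp.
rewrite addnS desc_weightS; apply: le_trans (_ : desc_weight delta r g (n + i) <= _).
  move: hp {hg hi}; elim: {2}(m) g => [|k IHk] {}g; first exact: IH.
  rewrite /partial_histories iterS => /allpairsPdep[h [x [hh xt ->]]].
  have hi := partial_histories_inv hh.
  rewrite (take_rcons_history _ (leq_addr i n) hi) desc_weight_rcons; last first.
    by rewrite mem_iota in xt; lia.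
  by apply: le_trans (IHk _ hh) _; rewrite lerDl.
rewrite lerDl; case: ifP => // _; apply: le_trans w0 _.
by rewrite lerD2r ler_nat; case/andP: (history_new_degree hi).
Qed.

Lemma nondesc_weight_nondecreasing (v : nat -> nat -> nat) : admissible m v ->
  nondecreasing_seq (fun t => nondesc_weight delta r (graph_at m v t) t).
Proof.
have w0 := ltW (min_weight_gt0 delta_gt).
move=> hv; apply/nondecreasing_seqP => t.
rewrite /graph_at partial_graph_next nondesc_weightS.
apply: le_trans (_ : nondesc_weight delta r (partial_graph m v t m) t <= _).
  suff H k : (k <= m)%N -> nondesc_weight delta r (partial_graph m v t 0) t <=
      nondesc_weight delta r (partial_graph m v t k) t by exact: H.
  elim: k => // k IH km; rewrite partial_graphS nondesc_weight_rcons; last first.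
    exact: hv.
  by apply: le_trans (IH (ltnW km)) _; rewrite lerDl.
have hi := partial_histories_inv (partial_graph_history t hv (leqnn m)).
rewrite lerDl; case: ifP => // _; apply: le_trans w0 _.
by rewrite lerD2r ler_nat; case/andP: (history_new_degree hi).
Qed.

Lemma nondesc_count_le (t : nat) (g : multigraph) : history_inv m t 0 g ->
  (\sum_(1 <= x < t.+1 | ~~ is_desc r g x) 1)%N%:R * (m%:R + delta)
    <= nondesc_weight delta r g t.
Proof.
move=> hg; rewrite natr_sum mulr_suml /nondesc_weight big_nat_cond.
rewrite [leRHS]big_nat_cond; apply: ler_sum => x /andP[xt _].
by rewrite mul1r; apply: (old_weight_ge delta hg).
Qed.

Lemma descendant_count_bounds (t : nat) (g : multigraph) : history_inv m t 0 g ->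
  t%:R - nondesc_weight delta r g t / (m%:R + delta)
    <= (descendant_count g r t)%:R :> R /\ (descendant_count g r t <= t)%N.
Proof.
move=> hg; have w0 := min_weight_gt0 delta_gt.
set c := (\sum_(1 <= x < t.+1 | ~~ is_desc r g x) 1)%N.
have e : (descendant_count g r t + c = t)%N.
  transitivity (\sum_(1 <= x < t.+1) 1)%N.
    by rewrite [RHS](bigID (is_desc r g)).
  by rewrite sum_nat_const_nat subn1 muln1.
split; last by rewrite -[leqRHS]e leq_addr.
rewrite -{1}e natrD lerBlDr lerD2l ler_pdivlMr //.
exact: nondesc_count_le.
Qed.

(** The non-descendants have total degree N - delta c, where c is their number; a negative delta
    costs at most |delta| c, and c <= N/(m + delta). *)
Lemma descendant_degree_bounds (t : nat) (g : multigraph) : history_inv m t 0 g ->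
  2 * m%:R * t%:R - (1 + `|delta| / (m%:R + delta)) * nondesc_weight delta r g t
    <= (descendant_degree g r t)%:R :> R /\
  (descendant_degree g r t <= 2 * m * t)%N.
Proof.
move=> hg; have w0 := min_weight_gt0 delta_gt.
set N := nondesc_weight delta r g t.
set c := (\sum_(1 <= x < t.+1 | ~~ is_desc r g x) 1)%N.
set e := (\sum_(1 <= x < t.+1 | ~~ is_desc r g x) degree g x)%N.
have tot : (descendant_degree g r t + e = 2 * m * t)%N.
  have := degree_total (history_ends hg).
  rewrite big_nat_recr //= (fresh_degree hg) addn0 (history_size hg) addn0.
  by rewrite (bigID (is_desc r g)) /= mulnA.
split; last by rewrite -tot leq_addr.
have NE : N = e%:R + delta * c%:R.
  rewrite /N /nondesc_weight big_split /= !natr_sum; congr (_ + _).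
  by rewrite mulr_sumr; apply: eq_bigr => x _; rewrite mulr1.
have cN : c%:R <= N / (m%:R + delta).
  by rewrite ler_pdivlMr //; exact: nondesc_count_le.
have : `|delta| * c%:R <= `|delta| * (N / (m%:R + delta)) by rewrite ler_wpM2l.
have : - (delta * c%:R) <= `|delta| * c%:R.
  by rewrite -mulNr ler_wpM2r // -normrN ler_norm.
have -> : 2 * m%:R * t%:R = (descendant_degree g r t)%:R + e%:R :> R.
  by rewrite -natrD tot !natrM.
rewrite mulrDl mul1r -mulrA [(m%:R + delta)^-1 * N]mulrC NE; lra.
Qed.

End Monotonicity.

(** * Almost sure convergence *)

Section Summability.
Variables (d : measure_display) (T : measurableType d) (R : realType).
Variables (P : probability T R) (m : nat) (delta : R) (w : nat -> nat -> T -> nat).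
Hypotheses (m_gt1 : (1 < m)%N) (delta_gt : - m%:R < delta).
Hypothesis hw : pref_attach P m delta w.

Lemma expect_one_le (n t : nat) : (1 <= n <= t)%N ->
  expect P m w t 0 (fun=> 1) <= expect P m w n 0 (fun=> 1).
Proof.
move=> /andP[n1 nt]; rewrite -(subnKC nt); elim: (t - n)%N => [|i IH].
  by rewrite addn0.
rewrite addnS (expectS hw) ?(leq_trans n1) ?leq_addr //; apply: le_trans IH.
apply: expect_le => g hg; apply: (attach_steps_cst 0) => //; last exact: histories_inv.
by rewrite (leq_trans n1) ?leq_addr.
Qed.

(** Taking expectations in the drift gives the recursion of [drift_sum_le], with C multiplied by the
    total mass of the histories at time n. The resulting bound on expected sums yields an almost
    sure one. *)
Lemma ae_summable_of_drift (f : nat -> multigraph -> R) (n : nat) (eps C : R) :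
  (1 <= n)%N -> 0 < eps -> 0 <= C ->
  (forall t g, (n <= t)%N -> g \in histories m t -> 0 <= f t g) ->
  (forall t g, (n <= t)%N -> g \in histories m t ->
    attach_steps m delta t 0 m (f t.+1) g <=
      (1 - eps / t%:R) * f t g + C / t%:R ^+ 2) ->
  {ae P, forall omega : T, admissible m (fun s j => w s j omega) ->
    exists L, forall M,
      \sum_(n <= t < M) f t (pa_graph m w t omega) / t%:R <= L}.
Proof.
move=> n1 eps0 C0 f0 fS.
set mass := expect P m w n 0 (fun=> 1).
have mass0 : 0 <= mass by exact: expect_ge0.
pose e t := expect P m w t 0 (f t).
have sumE := drift_sum_le (e := e) n1 eps0 (mulr_ge0 C0 mass0).
pose F t g := if (n <= t)%N then f t g / t%:R else 0.
have widen (h : nat -> R) M : \sum_(0 <= t < M) (if (n <= t)%N then h t else 0) =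
    \sum_(n <= t < M) h t.
  by rewrite (big_nat_widenl n 0) // [RHS]big_mkcond.
have := ae_bounded_partial_sums hw (F := F) (L := (e n + 2 * (C * mass) / n%:R) / eps).
move=> ae; apply: filterS (ae _ _) => {ae}.
- move=> omega h /h[L hL]; exists L => M; rewrite -widen.
  by apply: le_trans (hL M); rewrite /F.
- move=> t g hg; rewrite /F; case: ifP => // nt.
  by rewrite divr_ge0 // f0.
move=> M; rewrite (eq_bigr (fun t => if (n <= t)%N then e t / t%:R else 0)); last first.
  move=> t _; rewrite /e /expect /F; case: ifP => _.
    by rewrite mulr_suml; apply: eq_bigr => g _; rewrite mulrA.
  by rewrite big1 // => g _; rewrite mulr0.
rewrite widen; apply: sumE => t nt; first by apply: expect_ge0 => g; exact: f0.
have t1 : (1 <= t)%N by exact: leq_trans nt.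
rewrite /e (expectS hw) //.
apply: le_trans (_ : expect P m w t 0
  (fun g => (1 - eps / t%:R) * f t g + C / t%:R ^+ 2) <= _).
  by apply: expect_le => g; exact: fS.
have -> : expect P m w t 0 (fun g => (1 - eps / t%:R) * f t g + C / t%:R ^+ 2) =
    (1 - eps / t%:R) * expect P m w t 0 (f t)
    + C / t%:R ^+ 2 * expect P m w t 0 (fun=> 1).
  rewrite /expect !mulr_sumr -big_split /=; apply: eq_bigr => g _; ring.
rewrite lerD2l [leRHS]mulrAC ler_wpM2l //.
  by rewrite divr_ge0 // exprn_ge0.
by apply: expect_one_le; rewrite n1.
Qed.

End Summability.

Unset Implicit Arguments.

Theorem theorem2p3 (d : measure_display) (T : measurableType d) (R : realType)
    (P : probability T R) (m : nat) (delta : R) (r : nat)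
    (w : nat -> nat -> T -> nat)
    (hm : (1 < m)%N) (hdelta : - m%:R < delta) (hr : (0 < r)%N)
    (hw : pref_attach P m delta w) :
  {ae P, forall omega : T,
    (p_X R m w r t omega @[t --> \oo] --> (1 : R)) /\
    (p_Y R m w r t omega @[t --> \oo] --> (1 : R))}.
Proof.
have [K [eps [C [/andP[eps0 _] C0 drift]]]] := ratio_drift r hm hdelta.
have w0 := min_weight_gt0 hdelta.
pose Z g t := desc_weight delta r g t.
pose N g t := nondesc_weight delta r g t.
have Zge t g : (r <= t)%N -> g \in histories m t -> m%:R + delta <= Z g t.
  move=> rt hg; apply: (desc_weight_ge hm hdelta (histories_inv hg)).
  by rewrite hr.
have Z0 t g : (r <= t)%N -> g \in histories m t -> 0 < Z g t.
  by move=> rt hg; apply: lt_le_trans (Zge _ _ rt hg).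
have N0 t g : g \in histories m t -> 0 <= N g t.
  by move=> hg; apply: (nondesc_weight_ge0 r hm hdelta (histories_inv hg)).
have ae1 : {ae P, forall omega : T, admissible m (fun s j => w s j omega) ->
    exists L, forall M,
      \sum_(r <= t < M) (Z (pa_graph m w t omega) t)^-1 / t%:R <= L}.
  have /andP[g0 _] := growth_rate_bounds hm hdelta.
  apply: (ae_summable_of_drift (C := 0) hm hdelta hw
    (f := fun t g => (Z g t)^-1) hr g0) => //.
    by move=> t g rt hg; rewrite invr_ge0 ltW // Z0.
  move=> t g rt hg; rewrite mul0r addr0.
  apply: (inv_desc_drift hm hdelta); last exact: histories_inv.
  by rewrite hr.
(* The test on the prefix G(n) of g is unaffected by the steps after time n. *)
pose f n t g := if K <= Z (take (m * n) g) n then N g t / Z g t else 0.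
(* The time at which Z reaches K is random, so the statement is proved for every fixed n and then
   combined over countably many n. *)
have ae2 n : {ae P, forall omega : T, (r <= n)%N ->
    admissible m (fun s j => w s j omega) -> exists L, forall M,
      \sum_(n <= t < M) f n t (pa_graph m w t omega) / t%:R <= L}.
  have [rn|] := boolP (r <= n)%N; last by move=> _; exact: aeW.
  apply: (@filterS _ _ _ _ _ (fun omega h _ => h)).
  have n1 : (1 <= n)%N := leq_trans hr rn.
  apply: (ae_summable_of_drift hm hdelta hw (f := f n) n1 eps0 C0).
    move=> t g nt hg; rewrite /f; case: ifP => // _.
    by rewrite divr_ge0 ?N0 // ltW // Z0 // (leq_trans rn).
  move=> t g nt hg; have hi := histories_inv hg.
  have t0 : (0 < t)%N := leq_trans n1 nt.
  have rt : (r <= t)%N := leq_trans rn nt.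
  pose I (k : nat) h := take (m * n) h = take (m * n) g.
  have IS k h x : (k < m)%N -> history_inv m t k h -> I k h ->
      (1 <= x <= t.+1)%N -> I k.+1 (rcons h (t.+1, x)).
    by move=> _ hh Ih _; rewrite /I (take_rcons_history _ nt hh).
  (* If the test on the prefix fails, [f n] vanishes before and after the step. *)
  have [KZ|KZ] := boolP (K <= Z (take (m * n) g) n).
    rewrite {2}/f KZ.
    apply: le_trans (drift t g _ hi _); last 2 first.
    - by rewrite hr.
    - by apply: le_trans KZ _; exact: desc_weight_prefix_le.
    apply: (attach_steps_mono hm hdelta (I := I)) => // h hh Ih.
    by rewrite /f Ih KZ.
  rewrite {2}/f (negbTE KZ) mulr0 add0r.
  apply: le_trans (_ : attach_steps m delta t 0 m (fun=> 0) g <= _).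
    apply: (attach_steps_mono hm hdelta (I := I)) => // h hh Ih.
    by rewrite /f Ih (negbTE KZ).
  apply: le_trans (attach_steps_cst r hm hdelta 0 t0 _ hi) _ => //.
  by rewrite divr_ge0 ?exprn_ge0.
apply: filterS3 (ae_admissible hw) ae1 (ae_foralln ae2) => omega adm h1 h2.
have {h1}[L1 hL1] := h1 adm.
set G := fun t => pa_graph m w t omega in hL1.
have hG t : G t \in histories m t by exact: partial_graph_history.
have [n rn KZ] : exists2 n, (r <= n)%N & K <= Z (G n) n.
  apply: contrapT => h.
  have ZK t : (r <= t)%N -> Z (G t) t < K.
    by move=> rt; rewrite ltNge; apply/negP => KZ; apply: h; exists t.
  have K0 : 0 < K by apply: lt_trans (ZK _ (leqnn r)); apply: Z0.
  apply: (@harmonic_tail_unbounded _ K^-1 L1 r hr); first by rewrite invr_gt0.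
  move=> M; apply: le_trans (hL1 M); rewrite !big_nat; apply: ler_sum => t /andP[rt _].
  rewrite ler_wpM2r ?invr_ge0 // lef_pV2 ?posrE ?(Z0 _ _ rt (hG t)) //.
  exact: ltW (ZK _ rt).
have {h2}[L2 hL2] := h2 n rn adm.
have B0 : 0 < 2 * m%:R + delta by rewrite (lt_trans _ (rate_gt0 hm hdelta)).
(* Since Z <= B t, the term N/t^2 is at most B (N/Z)/t, whence the bound B L2. *)
have NT : N (G t) t / t%:R @[t --> \oo] --> (0 : R).
  apply: (@monotone_ratio_cvg0 _ (fun t => N (G t) t) n ((2 * m%:R + delta) * L2)).
  - by move=> t; exact: N0.
  - exact: (nondesc_weight_nondecreasing r hdelta adm).
  move=> M; rewrite mulrC -ler_pdivrMr // mulr_suml; apply: le_trans (hL2 M).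
  rewrite !big_nat; apply: ler_sum => t /andP[nt _].
  have rt : (r <= t)%N := leq_trans rn nt.
  rewrite /f take_partial_graph // -/(G n) KZ -/(G t).
  have t0 : 0 < t%:R :> R by rewrite ltr0n (leq_trans hr).
  have -> : N (G t) t / t%:R ^+ 2 / (2 * m%:R + delta) =
      N (G t) t / ((2 * m%:R + delta) * t%:R) / t%:R.
    by field; rewrite !lt0r_neq0.
  rewrite ler_wpM2r ?invr_ge0 // ler_wpM2l ?N0 // lef_pV2 ?posrE ?mulr_gt0 ?Z0 //.
  by rewrite -(total_weight0 delta r (histories_inv (hG t))) lerDr N0.
(* Both proportions are squeezed between this, for a suitable c, and 1. *)
have lower (c : R) : 1 - c * (N (G t) t / t%:R) @[t --> \oo] --> (1 : R).
  rewrite -[X in _ --> X]subr0 -(mulr0 c).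
  by apply: cvgB; [exact: cvg_cst | apply: cvgM => //; exact: cvg_cst].
split.
  apply: (squeeze_cvgr (h := fun=> 1)) (lower (m%:R + delta)^-1) _;
    last exact: cvg_cst.
  near=> t; have t0 : 0 < t%:R :> R.
    by rewrite ltr0n; near: t; exact: nbhs_infty_gt.
  have [h1 h2] := descendant_count_bounds r hdelta (histories_inv (hG t)).
  rewrite /p_X -/(G t) ler_pdivlMr // ler_pdivrMr // mul1r ler_nat h2 andbT.
  apply: le_trans h1; rewrite mulrBl mul1r lerD2l lerN2.
  by rewrite mulrA mulfVK ?lt0r_neq0 // mulrC.
apply: (squeeze_cvgr (h := fun=> 1))
  (lower ((1 + `|delta| / (m%:R + delta)) / (2 * m%:R))) _; last exact: cvg_cst.
near=> t; have t0 : 0 < t%:R :> R.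
  by rewrite ltr0n; near: t; exact: nbhs_infty_gt.
have m0 : 0 < m%:R :> R by rewrite ltr0n ltnW.
have [h1 h2] := descendant_degree_bounds r hdelta (histories_inv (hG t)).
rewrite /p_Y -/(G t) ler_pdivlMr ?mulr_gt0 // ler_pdivrMr ?mulr_gt0 // mul1r.
rewrite -!natrM ler_nat h2 andbT !natrM.
apply: le_trans h1; rewrite le_eqVlt; apply/orP; left; apply/eqP; rewrite /N.
by field; rewrite !lt0r_neq0.
Unshelve. all: by end_near. Qed.
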